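(* Consider the vehicle-service model and the NRPS policy $\boldsymbol\pi$ described in the context, with control parameters $\rho\in(0,\infty)$ and $\eta\in(0,\tfrac12)$, and assume that $\mu_{ij}^*=0$ for all links $(i,j)$ and $\hat\mu_{ij}^{d-1,*}=0$ for all links $(i,j)$ and all days $d$. Then there exist functions $\Phi_2(\rho,\eta)$, $\Phi_3(\rho,\eta)$, $\Phi_4(\rho,\eta)$ (not depending on $D$) such that (i) they are finite and positive for all $\rho\in(0,\infty)$ and $\eta\in(0,\tfrac12)$; and (ii) for all $D>4+e^{1/(1-2\eta)}$, $$\Delta_D^{\boldsymbol\pi}<\Phi_2(\rho,\eta)D^{-1}+\Phi_3(\rho,\eta)(\ln D)^{1/2}D^{\eta-\frac12}+\Phi_4(\rho,\eta)D^{-\eta}.$$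
   Context: Model. There are locations $\mathcal N=\{1,\dots,N\}$ and days $d=1,\dots,D$. For each ordered pair (link) $(i,j)$, $i\neq j$, there are unknown parameters $\boldsymbol\theta_{ij}=(\alpha_{ij},\beta_{ij})$ with $0<\alpha_{\min}\le\alpha_{ij}\le\alpha_{\max}$, $0<\beta_{\min}\le\beta_{ij}\le\beta_{\max}$ (only these bounds are known to the provider), a travel time $\xi_{ij}>0$, and demand shocks $\epsilon_{ij}^d\in[\underline\epsilon,\overline\epsilon]$; for each link, $\{\epsilon_{ij}^d\}_{d=1,\dots,D}$ are i.i.d. with known c.d.f. $F_{ij}$ and mean $0$. Let $\epsilon_{ij}^-:=\int_{\underline\epsilon}^0x\,dF_{ij}(x)$. There is a maximum price $p_{\max}$ and a per-slot cost $c$ with $0<c<p_{\max}$, and $\alpha_{\min}-\beta_{\max}p_{\max}+\underline\epsilon\ge0$. On day $d$ the provider picks prices $p_{ij}^d\le p_{\max}$ and supplies $w_{ij}^d\ge0$ with flow balance $\sum_{j\neq i}w_{ij}^d=\sum_{j\neq i}w_{ji}^d$ for all $i$; realized demand $\Psi_{ij}^d=\alpha_{ij}-\beta_{ij}p_{ij}^d+\epsilon_{ij}^d$ is observed. Payoff per slot: $\Pi(\mathbf p,\mathbf w,\boldsymbol\epsilon)=\sum_i\sum_{j\neq i}\xi_{ij}\min\{\alpha_{ij}-\beta_{ij}p_{ij}+\epsilon_{ij},w_{ij}\}p_{ij}-\sum_i\sum_{j\neq i}\xi_{ij}w_{ij}c$. Optimization problem for parameters $\hat{\boldsymbol\theta}=(\hat\alpha_{ij},\hat\beta_{ij})$: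 maximize $\sum_i\sum_{j\neq i}\xi_{ij}\mathbb E_{\epsilon_{ij}}\{\min\{\hat\alpha_{ij}-\hat\beta_{ij}p_{ij}+\epsilon_{ij},w_{ij}\}\}p_{ij}-\sum_i\sum_{j\neq i}\xi_{ij}w_{ij}c$ subject to flow balance, $w_{ij}=\hat\alpha_{ij}-\hat\beta_{ij}p_{ij}$, $p_{ij}\le p_{\max}$, $w_{ij}\ge0$; its optimal solution is denoted $(\mathbf p^*(\hat{\boldsymbol\theta}),\mathbf w^*(\hat{\boldsymbol\theta}))$. Substituting $w_{ij}=\hat\alpha_{ij}-\hat\beta_{ij}p_{ij}$, it is equivalent to maximizing $\sum\xi_{ij}(\hat\alpha_{ij}-\hat\beta_{ij}p_{ij}+\epsilon_{ij}^-)p_{ij}-\sum\xi_{ij}(\hat\alpha_{ij}-\hat\beta_{ij}p_{ij})c$ subject to $\sum_{j\neq i}(\hat\alpha_{ij}-\hat\beta_{ij}p_{ij})=\sum_{j\neq i}(\hat\alpha_{ji}-\hat\beta_{ji}p_{ji})$ for all $i$ and $p_{ij}\le p_{\max}$. With the true $\boldsymbol\theta$ this gives the clairvoyant decisions $(\mathbf p^*(\boldsymbol\theta),\mathbf w^*(\boldsymbol\theta))$, and $\mu_{ij}^*$ denotes the optimal dual variable of $p_{ij}\le p_{\max}$ in the price-only problem with $\boldsymbol\theta$; $\hat\mu_{ij}^{d-1,*}$ denotes the same dual variable in the price-only problem with $\hat{\boldsymbol\theta}^{d-1}$. Estimates: for $t\ge1$, $\tilde{\boldsymbol\theta}_{ij}^t$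 minimizes $\sum_{\tau=1}^t(\Psi_{ij}^\tau-(\bar\alpha-\bar\beta p_{ij}^\tau))^2$ over $(\bar\alpha,\bar\beta)\in\mathbb R^2$, and $\hat{\boldsymbol\theta}_{ij}^t$ is obtained by clipping $\tilde\alpha_{ij}^t$ to $[\alpha_{\min},\alpha_{\max}]$ and $\tilde\beta_{ij}^t$ to $[\beta_{\min},\beta_{\max}]$. NRPS policy $\boldsymbol\pi$: $\hat{\boldsymbol\theta}_{ij}^0$ is drawn from $[\alpha_{\min},\alpha_{\max}]\times[\beta_{\min},\beta_{\max}]$ by an arbitrary distribution; $\rho\in(0,\infty)$, $\eta\in(0,\frac12)$. On odd day $d$: compute $\hat{\boldsymbol\theta}^{d-1}$ (least squares for $d\ge3$) and implement $(\mathbf p^*(\hat{\boldsymbol\theta}^{d-1}),\mathbf w^*(\hat{\boldsymbol\theta}^{d-1}))$. On even day $d$: implement $p_{ij}^d=p_{ij}^*(\hat{\boldsymbol\theta}^{d-2})-\frac{\rho}{\hat\beta_{ij}^{d-2}}d^{-\eta}$, $w_{ij}^d=w_{ij}^*(\hat{\boldsymbol\theta}^{d-2})+\rho d^{-\eta}$. Time-average regret: $\Delta_D^{\boldsymbol\pi}=\mathbb E^{\boldsymbol\pi}\{\frac1D\sum_{d=1}^D(\Pi(\mathbf p^*(\boldsymbol\theta),\mathbf w^*(\boldsymbol\theta),\boldsymbol\epsilon^d)-\Pi(\mathbf p^d,\mathbf w^d,\boldsymbol\epsilon^d))\}$, expectation over the shocks and the policy's randomness. *)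

(* Defs.v *)
From HB Require Import structures.
From mathcomp Require Import all_boot all_order all_algebra.
From mathcomp Require Import all_classical all_reals all_analysis.
Set Implicit Arguments. Unset Strict Implicit. Unset Printing Implicit Defensive.
Import Order.TTheory GRing.Theory Num.Theory.
Local Open Scope classical_set_scope.
Local Open Scope ring_scope.

Section VehicleModel.
Variables (R : realType) (N : nat).

(* Link-indexed quantities: x i j for the ordered pair (i,j); only i != j matter. *)
Definition lnk := 'I_N -> 'I_N -> R.

Definition in_box (amin amax bmin bmax : R) (a b : lnk) : Prop :=
  forall i j : 'I_N, i != j -> amin <= a i j <= amax /\ bmin <= b i j <= bmax.

Definition clip (lo hi x : R) : R := Num.min (Num.max x lo) hi.

Definition obj (xi em : lnk) (c : R) (a b p : lnk) : R :=
  \sum_(i < N) \sum_(j < N | j != i) xi i j * (a i j - b i j * p i j + em i j) * p i j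
  - \sum_(i < N) \sum_(j < N | j != i) xi i j * (a i j - b i j * p i j) * c.

(* flow-balance residual at location i: outflow minus inflow, with w = a - b p *)
Definition flow_res (a b p : lnk) (i : 'I_N) : R :=
  \sum_(j < N | j != i) (a i j - b i j * p i j)
  - \sum_(j < N | j != i) (a j i - b j i * p j i).

Definition feasible (pmax : R) (a b p : lnk) : Prop :=
  (forall i : 'I_N, flow_res a b p i = 0) /\
  (forall i j : 'I_N, i != j -> p i j <= pmax).

Definition is_opt (xi em : lnk) (c pmax : R) (a b p : lnk) : Prop :=
  feasible pmax a b p /\
  forall q : lnk, feasible pmax a b q -> obj xi em c a b q <= obj xi em c a b p.

Definition lagr (xi em : lnk) (c pmax : R) (a b : lnk)
  (lam : 'I_N -> R) (mu : lnk) (p : lnk) : R :=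
  obj xi em c a b p + \sum_(i < N) lam i * flow_res a b p i
  + \sum_(i < N) \sum_(j < N | j != i) mu i j * (pmax - p i j).

Definition dualfun (xi em : lnk) (c pmax : R) (a b : lnk)
  (lam : 'I_N -> R) (mu : lnk) : \bar R :=
  ereal_sup (range (fun p : lnk => (lagr xi em c pmax a b lam mu p)%:E)).

Definition dual_feas (mu : lnk) : Prop := forall i j : 'I_N, i != j -> 0 <= mu i j.

Definition dual_opt (xi em : lnk) (c pmax : R) (a b : lnk)
  (lam : 'I_N -> R) (mu : lnk) : Prop :=
  dual_feas mu /\
  forall (lam' : 'I_N -> R) (mu' : lnk), dual_feas mu' ->
    (dualfun xi em c pmax a b lam mu <= dualfun xi em c pmax a b lam' mu')%E.

Definition zero_cap_dual (xi em : lnk) (c pmax : R) (a b : lnk) : Prop :=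
  exists (lam : 'I_N -> R) (mu : lnk),
    dual_opt xi em c pmax a b lam mu /\ forall i j : 'I_N, i != j -> mu i j = 0.

Definition payoff (xi alpha beta : lnk) (c : R) (p w e : lnk) : R :=
  \sum_(i < N) \sum_(j < N | j != i)
     xi i j * Num.min (alpha i j - beta i j * p i j + e i j) (w i j) * p i j
  - \sum_(i < N) \sum_(j < N | j != i) xi i j * w i j * c.

Definition is_LS (t : nat) (x y : nat -> R) (a b : R) : Prop :=
  forall a' b' : R,
    \sum_(1 <= tau < t.+1) (y tau - (a - b * x tau)) ^+ 2
    <= \sum_(1 <= tau < t.+1) (y tau - (a' - b' * x tau)) ^+ 2.

End VehicleModel.

Section Stochastic.
Local Open Scope ring_scope.
Context (dsp : measure_display) (Omega : measurableType dsp) (R : realType)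
  (N : nat) (P : probability Omega R).
(* eps dd w i j = shock on link (i,j) on day dd (days dd >= 1) *)
Variable eps : nat -> Omega -> lnk R N.
(* initial (random) estimate theta^0 = (a0, b0) *)
Variables a0 b0 : Omega -> lnk R N.

Definition shock_rect (dd : nat) (x : lnk R N) : set Omega :=
  [set w | forall i j : 'I_N, i != j -> eps dd w i j <= x i j].

Definition init_rect (a b : lnk R N) : set Omega :=
  [set w | forall i j : 'I_N, i != j -> a0 w i j <= a i j /\ b0 w i j <= b i j].

(* The daily shock vectors eps^1, eps^2, ... are identically distributed
   (same joint c.d.f.), and the family (theta^0, eps^1, eps^2, ...) is mutually
   independent (product rule for the joint c.d.f.s of every finite subfamily). *)
Definition shocks_iid_indep : Prop :=
  (forall (dd : nat) (x : lnk R N), (0 < dd)%N ->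
      P (shock_rect dd x) = P (shock_rect 1 x)) /\
  (forall (S : seq nat) (x : nat -> lnk R N) (a b : lnk R N),
      uniq S -> all (fun dd => 0 < dd)%N S ->
      P (init_rect a b `&` \bigcap_(dd in [set` S]) shock_rect dd (x dd))
      = (P (init_rect a b) * \prod_(dd <- S) P (shock_rect dd (x dd)))%E).

(* eps^-_ij = int_{lo}^0 x dF_ij(x) = E[min(eps_ij, 0)] *)
Definition epsminus : lnk R N :=
  fun i j => fine (\int[P]_w (Num.min (eps 1 w i j) 0)%:E).

Definition nrps_run (alpha beta : lnk R N) (amin amax bmin bmax : R)
  (pstar : lnk R N -> lnk R N -> lnk R N) (rho eta : R)
  (price supply ahat bhat atil btil : nat -> Omega -> lnk R N) : Prop :=
  forall w : Omega,
  (forall i j : 'I_N, i != j -> ahat 0%N w i j = a0 w i j /\ bhat 0%N w i j = b0 w i j) /\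
  (forall t : nat, (0 < t)%N -> forall i j : 'I_N, i != j ->
     is_LS t (fun tau => price tau w i j)
             (fun tau => alpha i j - beta i j * price tau w i j + eps tau w i j)
             (atil t w i j) (btil t w i j) /\
     ahat t w i j = clip amin amax (atil t w i j) /\
     bhat t w i j = clip bmin bmax (btil t w i j)) /\
  (forall dd : nat, odd dd -> forall i j : 'I_N, i != j ->
     price dd w i j = pstar (ahat dd.-1 w) (bhat dd.-1 w) i j /\
     supply dd w i j = ahat dd.-1 w i j - bhat dd.-1 w i j * price dd w i j) /\
  (forall dd : nat, (0 < dd)%N -> ~~ odd dd -> forall i j : 'I_N, i != j ->
     price dd w i j = pstar (ahat (dd - 2)%N w) (bhat (dd - 2)%N w) i j
                      - rho / bhat (dd - 2)%N w i j * (dd%:R `^ (- eta)) /\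
     supply dd w i j = (ahat (dd - 2)%N w i j
                        - bhat (dd - 2)%N w i j * pstar (ahat (dd - 2)%N w) (bhat (dd - 2)%N w) i j)
                       + rho * (dd%:R `^ (- eta))).

Definition regret (xi alpha beta : lnk R N) (c : R) (pstar : lnk R N -> lnk R N -> lnk R N)
  (price supply : nat -> Omega -> lnk R N) (D : nat) : \bar R :=
  \int[P]_w ((D%:R)^-1 * \sum_(1 <= dd < D.+1)
     (payoff xi alpha beta c (pstar alpha beta)
             (fun i j => alpha i j - beta i j * pstar alpha beta i j) (eps dd w)
      - payoff xi alpha beta c (price dd w) (supply dd w) (eps dd w)))%:E.

End Stochastic.

(* Main.v *)
Require Import Defs.
From HB Require Import structures.
From mathcomp Require Import all_boot all_order all_algebra.
From mathcomp Require Import all_classical all_reals all_analysis.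
From mathcomp Require Import measurable_realfun ring lra zify.
Import Order.TTheory GRing.Theory Num.Theory.
Import numFieldNormedType.Exports.
Local Open Scope classical_set_scope.
Local Open Scope ring_scope.

(* The regret bound is of first order, so it suffices that the daily loss is
   Lipschitz in the parameter error plus the price perturbation d^-eta.  When the
   cap multipliers vanish, an optimal price vector is the maximiser of a separable
   quadratic Lagrangian; subtracting the stationarity conditions of two parameter
   vectors and testing against the (balanced) flow difference shows that optimal
   prices are Lipschitz in the parameters.  The least-squares error on a link is
   at most (normalised noise) / (Gram determinant), up to constants: the
   perturbations force the determinant to grow like t^(2-2 eta), while the
   normalised noise S^T V^-1 S grows at most like ln t plus a sum of terms
   eps_(tau+1) * g_tau, with g_tau a function of the history up to tau.  These
   terms have mean zero by independence.  AM-GM with the weight sqrt(1 + ln D)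
   turns the squared error into the error itself, and powers of d are summed. *)

(** * Independence of a shock from functions of the past *)

(** Three obstacles shape the argument. The self-normalised form is therefore followed in time: each
    new shock is independent of the gain that multiplies it. Next, [pstar] is given only as a choice
    of optimisers, without regularity, and independence only through joint distribution functions.
    The Lipschitz estimate at the realised estimates gives continuity in the history, hence
    measurability with respect to it, and uniqueness of measures carries the product rule from
    rectangles to all past events. Finally, the regret is an integral of a function not known to be
    measurable, so every inequality is kept pathwise, as a deterministic bound plus a bounded
    mean-zero remainder, and integrated once at the end. AM-GM makes this possible, because no
    square root of an expectation appears. The three terms of the bound come from the two days
    before any data are used, from learning at rate [t^(eta - 1/2)], and from the perturbations
    themselves. *)

(* Measurability with respect to the past is obtained from continuity: a
   function that is continuous in finitely many measurable coordinates is
   measurable with respect to them. *)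
Definition nearby {T : Type} {R : realType} {I : Type} (X : I -> T -> R) (w : T)
    : set_system T :=
  filter_from [set e : R | 0 < e]
    (fun e => [set v | forall k, `|X k v - X k w| < e]).

#[global] Instance nearby_filter {T : Type} {R : realType} {I : Type} (X : I -> T -> R) (w : T) :
  Filter (nearby X w).
Proof.
apply: filter_from_filter; first by exists 1 => /=.
move=> e1 e2 /= e10 e20; exists (Num.min e1 e2); first by rewrite /= lt_min e10.
by move=> v /= vX; split=> k; have := vX k; rewrite lt_min => /andP[].
Qed.

Lemma nearby_coord (T : Type) (R : realType) (I : Type) (X : I -> T -> R) (w : T) (k : I) :
  X k @ nearby X w --> X k w.
Proof.
apply/cvgrPdist_lt => e e0; exists e => //= v vX.
by rewrite distrC; exact: vX.
Qed.

(** The preimage of an open ray is a union of coordinate boxes with rational centres and radii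
    [1 / n.+1], and there are only countably many of these. *)
Lemma nearby_measurable d (T : measurableType d) (R : realType) (I : finType)
    (X : I -> T -> R) (g : T -> R) :
  (forall k, measurable_fun setT (X k)) ->
  (forall w, g @ nearby X w --> g w) -> measurable_fun setT g.
Proof.
move=> mX cg; apply: (measurability _ (RGenOInfty.measurableE R)) => //.
move=> /= _ [_ [a ->] <-]; rewrite setTI.
pose box (z : {ffun I -> rat} * nat) : set T :=
  \bigcap_(k in [set: I]) (X k @^-1` ball (ratr (z.1 k) : R) z.2.+1%:R^-1).
pose U := \bigcup_z (if `[< box z `<=` g @^-1` `]a, +oo[ >] then box z else set0).
suff -> : g @^-1` `]a, +oo[ = U.
  apply: countable_bigcupT_measurable; first exact: countableP.
  move=> z; case: ifPn => // _; apply: fin_bigcap_measurable => // k _.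
  by rewrite -[_ @^-1` _]setTI; apply: mX => //; exact: measurable_ball.
apply/seteqP; split=> [w /= gw|w [z _]]; last by case: ifPn => // /asboolP + bw; exact.
have /(cg w) [e /= e0 He] : nbhs (g w) `]a, +oo[%classic.
  by move: gw; rewrite in_itv/= andbT => /lt_nbhsr; apply: filterS => y /=; rewrite in_itv/= andbT.
(* Two points of one box differ in each coordinate by less than twice its radius. *)
have [n ne] : exists n : nat, n.+1%:R^-1 < e / 2.
  have [n _ /(_ _ (leqnn n)) nh] := near_infty_natSinv_lt (PosNum (divr_gt0 e0 (@ltr0Sn R 1))).
  by exists n.
have q k : exists q : rat, `|X k w - ratr q| < n.+1%:R^-1 :> R.
  have n0 : 0 < n.+1%:R^-1 :> R by rewrite invr_gt0.
  have [q /[!in_itv]/= /andP[q1 q2]] : exists q : rat, ratr q \in `]X k w, X k w + n.+1%:R^-1[.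
    by apply: rat_in_itvoo; rewrite ltrDl.
  exists q; rewrite ltr_distlC q2 andbT; apply: (lt_trans _ q1).
  by rewrite ltrBlDr ltrDl.
exists ([ffun k => projT1 (cid (q k))], n) => //.
have bw : box ([ffun k => projT1 (cid (q k))], n) w.
  move=> k _ /=; rewrite /ball/= ffunE distrC; exact: (projT2 (cid (q k))).
case: ifPn => // /asboolP; case=> v bv; apply: He => k /=.
have := bw k Logic.I; have := bv k Logic.I; rewrite /= /ball/= => bv' bw'.
rewrite -(subrKA (ratr ([ffun k => projT1 (cid (q k))] k))).
apply: (le_lt_trans (ler_normD _ _)); rewrite (splitr e) ltrD//.
  by rewrite distrC (lt_trans bv').
by rewrite (lt_trans bw').
Qed.

Definition bounded_measurable d (T : measurableType d) (R : realType) (Z : T -> R) : Prop :=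
  measurable_fun setT Z /\ exists C : R, forall w, `|Z w| <= C.

(** * Means of bounded random variables *)

Section BoundedIntegrals.
Context d (T : measurableType d) (R : realType) (P : probability T R).
Implicit Types Z g : T -> R.
Local Notation bm := (@bounded_measurable d T R).
Local Notation "''E' Z" := (Rintegral P setT Z) (at level 10, Z at level 8).

Lemma bounded_measurable_integrable Z : bm Z -> P.-integrable setT (EFin \o Z).
Proof.
move=> [mZ [C ZC]]; apply: measurable_bounded_integrable => //.
  by apply: (le_lt_trans (probability_le1 P measurableT)); exact: ltry.
exists C; split; first exact: num_real.
by move=> M CM w _ /=; rewrite (le_trans (ZC w))// ltW.
Qed.

Lemma bounded_measurable_cst (a : R) : bm (fun=> a).
Proof. by split; [exact: measurable_cst|exists `|a|]. Qed.

Lemma bounded_measurableD Z1 Z2 : bm Z1 -> bm Z2 -> bm (fun w => Z1 w + Z2 w).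
Proof.
move=> [m1 [C1 b1]] [m2 [C2 b2]]; split; first exact: measurable_funD.
by exists (C1 + C2) => w; rewrite (le_trans (ler_normD _ _))// lerD.
Qed.

Lemma bounded_measurableM Z1 Z2 : bm Z1 -> bm Z2 -> bm (fun w => Z1 w * Z2 w).
Proof.
move=> [m1 [C1 b1]] [m2 [C2 b2]]; split; first exact: measurable_funM.
by exists (C1 * C2) => w; rewrite normrM ler_pM.
Qed.

Lemma bounded_measurable_sum (I : Type) (s : seq I) (p : pred I) (Z : I -> T -> R) :
  (forall i, p i -> bm (Z i)) -> bm (fun w => \sum_(i <- s | p i) Z i w).
Proof.
move=> bZ; elim: s => [|i s IH].
  by under [X in bm X]eq_fun do rewrite big_nil; exact: bounded_measurable_cst.
case pi: (p i); under [X in bm X]eq_fun do rewrite big_cons pi; last exact: IH.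
by apply: bounded_measurableD => //; exact: bZ.
Qed.

Lemma bounded_measurable_le Z (x : R) : measurable_fun setT Z -> bm (fun w => (Z w <= x)%R%:R).
Proof.
move=> mZ; split; last first.
  by exists 1 => w; case: (Z w <= x); rewrite ?normr1 ?normr0.
have -> : (fun w => (Z w <= x)%R%:R) = \1_(Z @^-1` `]-oo, x]) :> (T -> R).
  by apply/funext => w; rewrite indicE; congr (nat_of_bool _)%:R;
    apply/idP/idP; rewrite inE/= in_itv.
by apply: measurable_indic; rewrite -[_ @^-1` _]setTI; exact: mZ.
Qed.

Lemma meanZ (a : R) Z : bm Z -> 'E (fun w => a * Z w) = a * 'E Z.
Proof. by move=> bZ; rewrite RintegralZl//; exact: bounded_measurable_integrable. Qed.

Lemma meanD Z1 Z2 : bm Z1 -> bm Z2 -> 'E (fun w => Z1 w + Z2 w) = 'E Z1 + 'E Z2.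
Proof. by move=> b1 b2; rewrite RintegralD//; exact: bounded_measurable_integrable. Qed.

Lemma mean_cst (a : R) : 'E (fun=> a) = a.
Proof. rewrite Rintegral_cst//; have /= -> := @probability_setT _ _ _ P; by rewrite mulr1. Qed.

Lemma mean_sum (I : Type) (s : seq I) (Z : I -> T -> R) :
  (forall i, bm (Z i)) ->
  'E (fun w => \sum_(i <- s) Z i w) = \sum_(i <- s) 'E (Z i).
Proof.
move=> bZ; elim: s => [|i s IH].
  by under [X in 'E X]eq_fun do rewrite big_nil; rewrite mean_cst big_nil.
under [X in 'E X]eq_fun do rewrite big_cons.
by rewrite meanD ?IH ?big_cons//; exact: bounded_measurable_sum.
Qed.

Lemma mean_le Z1 Z2 : bm Z1 -> bm Z2 -> (forall w, Z1 w <= Z2 w) -> 'E Z1 <= 'E Z2.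
Proof. by move=> b1 b2 Z12; apply: le_Rintegral => //; exact: bounded_measurable_integrable. Qed.

Lemma mean_norm_le Z (C : R) : bm Z -> (forall w, `|Z w| <= C) -> `|'E Z| <= C.
Proof.
move=> bZ ZC; rewrite ler_norml -{1}(mean_cst (- C)) -{2}(mean_cst C).
by apply/andP; split; apply: mean_le => //; try exact: bounded_measurable_cst;
  move=> w; have := ZC w; rewrite ler_norml => /andP[].
Qed.

(** The subtracted expression rounds [y] down to a grid of mesh [h]. It is written through the
    events [y <= x] alone, so that its mean depends only on distribution functions. *)
Lemma staircase_approx (lo h y : R) (n : nat) : 0 <= h -> lo <= y <= lo + n%:R * h ->
  0 <= y - (lo + n%:R * h - h * \sum_(0 <= k < n) (y <= lo + k.+1%:R * h)%R%:R) <= h.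
Proof.
move=> h0; elim: n => [|n IH] /andP[loy yn].
  by rewrite big_geq// mul0r mulr0 in yn *; lra.
have e1 : (y <= lo + n.+1%:R * h)%R%:R = 1 :> R by rewrite yn.
rewrite big_nat_recr//= e1.
case: (lerP y (lo + n%:R * h)) => yn'.
  have /IH : lo <= y <= lo + n%:R * h by rewrite loy.
  by rewrite -natr1 => /andP[? ?]; apply/andP; split; lra.
rewrite big_nat big1 => [|k /andP[_ kn]].
  by move: yn; rewrite -natr1 => ?; apply/andP; split; lra.
rewrite leNgt (le_lt_trans _ yn')//= lerD2l ler_wpM2r// ler_nat.
by lia.
Qed.

(** Replacing [g1] and [g2] by their staircases makes both sides equal by hypothesis. The error is
    uniform, at most the bound of the weight times the mesh, and tends to 0. *)
Lemma mean_mul_eq_cdf (Z1 Z2 g1 g2 : T -> R) (lo hi : R) :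
  bm Z1 -> bm Z2 -> measurable_fun setT g1 -> measurable_fun setT g2 ->
  (forall w, lo <= g1 w <= hi) -> (forall w, lo <= g2 w <= hi) ->
  (forall x, 'E (fun w => Z1 w * (g1 w <= x)%R%:R) = 'E (fun w => Z2 w * (g2 w <= x)%R%:R)) ->
  'E (fun w => Z1 w * g1 w) = 'E (fun w => Z2 w * g2 w).
Proof.
move=> b1 b2 m1 m2 r1 r2 E12.
(* At [x = hi] both indicators are constantly 1. The constant term of the staircase needs this
   equality. *)
have EZ : 'E Z1 = 'E Z2.
  have := E12 hi; congr (_ = _); congr Rintegral; apply/funext => w.
    by have /andP[_ ->] := r1 w; rewrite mulr1.
  by have /andP[_ ->] := r2 w; rewrite mulr1.
have bg g : measurable_fun setT g -> (forall w, lo <= g w <= hi) -> bm g.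
  move=> mg rg; split => //; exists (`|lo| + `|hi|) => w.
  have := rg w => /andP[? ?]; rewrite ler_norml.
  have := ler_norm hi; have := ler_norm (- lo); rewrite normrN.
  have := normr_ge0 hi; have := normr_ge0 lo; lra.
have [C1 C1P] := b1.2; have [C2 C2P] := b2.2.
have [w0 _] : exists w0 : T, True by exists point.
have lohi : lo <= hi by have /andP[/le_trans] := r1 w0; exact.
have C10 : 0 <= C1 := le_trans (normr_ge0 _) (C1P w0).
have C20 : 0 <= C2 := le_trans (normr_ge0 _) (C2P w0).
pose s n (g : T -> R) w := lo + n%:R * ((hi - lo) / n%:R) - (hi - lo) / n%:R *
   \sum_(0 <= k < n) (g w <= lo + k.+1%:R * ((hi - lo) / n%:R))%R%:R.
have bs n g : measurable_fun setT g -> bm (s n g).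
  move=> mg; apply: bounded_measurableD; first exact: bounded_measurable_cst.
  under eq_fun do rewrite -mulNr; apply: bounded_measurableM; first exact: bounded_measurable_cst.
  by apply: bounded_measurable_sum => k _; exact: bounded_measurable_le.
have Es n Z g : bm Z -> measurable_fun setT g -> 'E (fun w => Z w * s n g w) =
    (lo + n%:R * ((hi - lo) / n%:R)) * 'E Z - (hi - lo) / n%:R *
      \sum_(0 <= k < n) 'E (fun w => Z w * (g w <= lo + k.+1%:R * ((hi - lo) / n%:R))%R%:R).
  move=> bZ mg; rewrite -mulNr -meanZ// -mean_sum; last first.
    by move=> k; apply: bounded_measurableM => //; exact: bounded_measurable_le.
  rewrite -meanZ; last by apply: bounded_measurable_sum => k _; apply: bounded_measurableM => //; exact: bounded_measurable_le.
  rewrite -meanD; last 2 first.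
    by apply: bounded_measurableM => //; exact: bounded_measurable_cst.
    apply: bounded_measurableM; first exact: bounded_measurable_cst.
    by apply: bounded_measurable_sum => k _; apply: bounded_measurableM => //; exact: bounded_measurable_le.
  by congr Rintegral; apply/funext => w; rewrite -mulr_sumr /s; ring.
have Ess n : 'E (fun w => Z1 w * s n g1 w) = 'E (fun w => Z2 w * s n g2 w).
  by rewrite !Es// EZ; congr (_ - _ * _); apply: eq_bigr.
have Ea n Z g C : bm Z -> (forall w, `|Z w| <= C) -> measurable_fun setT g ->
    (forall w, lo <= g w <= hi) ->
    `|'E (fun w => Z w * g w) - 'E (fun w => Z w * s n.+1 g w)| <= C * ((hi - lo) / n.+1%:R).
  move=> bZ ZC mg rg.
  rewrite -mulN1r -meanZ; last by apply: bounded_measurableM => //; exact: bs.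
  have bgg := bg _ mg rg.
  rewrite -meanD; last 2 first.
    by apply: bounded_measurableM.
    by apply: bounded_measurableM; [exact: bounded_measurable_cst|apply: bounded_measurableM => //; exact: bs].
  apply: mean_norm_le.
    apply: bounded_measurableD; first exact: bounded_measurableM.
    by apply: bounded_measurableM; [exact: bounded_measurable_cst|apply: bounded_measurableM => //; exact: bs].
  move=> w; rewrite mulN1r -mulrBr normrM ler_pM//.
  have h0 : 0 <= (hi - lo) / n.+1%:R by rewrite divr_ge0// subr_ge0.
  have nh : n.+1%:R * ((hi - lo) / n.+1%:R) = hi - lo by rewrite mulrC divfK ?pnatr_eq0.
  have /andP[s0 sh] : 0 <= g w - s n.+1 g w <= (hi - lo) / n.+1%:R.
    by apply: staircase_approx => //; rewrite nh subrKC.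
  by rewrite ger0_norm.
apply/eqP; rewrite -subr_eq0 -normr_eq0 eq_le normr_ge0 andbT.
apply/ler_addgt0Pr => e e0; rewrite add0r.
pose K := (C1 + C2) * (hi - lo).
have K0 : 0 <= K by apply: mulr_ge0; [exact: addr_ge0|rewrite subr_ge0].
have [n _ /(_ _ (leqnn n)) nh] :=
  near_infty_natSinv_lt (PosNum (divr_gt0 e0 (ltr_pwDr ltr01 K0))).
have /= := Ea n _ _ _ b1 C1P m1 r1; have /= := Ea n _ _ _ b2 C2P m2 r2.
rewrite Ess distrC => e1 e2.
have := lerD e2 e1 => /(le_trans (ler_normD _ _)); rewrite subrKA => /le_trans; apply.
rewrite -mulrDl mulrA -/K.
have n0 : 0 < n.+1%:R^-1 :> R by rewrite invr_gt0.
move: nh => /=; rewrite ltr_pdivlMr ?ltr_pwDr// mulrC => nh.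
by apply: le_trans (ltW nh); rewrite ler_pM2r// lerDl.
Qed.

End BoundedIntegrals.

(** * The past, and its independence from later shocks *)

Section History.
Context (dsp : measure_display) (Omega : measurableType dsp) (R : realType)
  (N : nat) (P : probability Omega R).
Variables (eps : nat -> Omega -> lnk R N) (a0 b0 : Omega -> lnk R N).
Variables (amin amax bmin bmax elo ehi : R).
Hypothesis box0 : forall w, in_box amin amax bmin bmax (a0 w) (b0 w).
Hypothesis eps_rng : forall (dd : nat) (w : Omega) (i j : 'I_N), i != j ->
  elo <= eps dd w i j <= ehi.
Hypothesis eps_meas : forall (dd : nat) (i j : 'I_N),
  measurable_fun setT (fun w => eps dd w i j).
Hypothesis eps_mean : forall i j : 'I_N, i != j -> (\int[P]_w (eps 1%N w i j)%:E = 0)%E.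
Hypothesis indep : shocks_iid_indep P eps a0 b0.
Hypothesis a0_meas : forall i j : 'I_N, measurable_fun setT (fun w => a0 w i j).
Hypothesis b0_meas : forall i j : 'I_N, measurable_fun setT (fun w => b0 w i j).

(* Coordinates 0 and 1 are the initial estimate, coordinate t.+2 is the shock of
   day t.+1. *)
Definition hist_coord (m : nat) (k : 'I_m.+2 * 'I_N * 'I_N) (w : Omega) : R :=
  if k.1.2 == k.2 then 0 else
  match val k.1.1 with
  | 0 => a0 w k.1.2 k.2 | 1 => b0 w k.1.2 k.2 | t.+2 => eps t.+1 w k.1.2 k.2
  end.

Definition hist_nbhs (m : nat) (w : Omega) := nearby (hist_coord m) w.

(** A pi-system generating the past of day [m.+1], made of the very events whose probabilities
    [shocks_iid_indep] factorises. *)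
Definition hist_rect (m : nat) : set (set Omega) :=
  [set A | exists a b x, A = init_rect a0 b0 a b `&`
     \bigcap_(dd in [set` iota 1 m]) shock_rect eps dd (x dd)].

Lemma measurable_le_link (X : Omega -> lnk R N) (i j : 'I_N) (r : R) :
  measurable_fun setT (fun w => X w i j) -> measurable [set w | X w i j <= r].
Proof.
move=> mX; have -> : [set w | X w i j <= r] = (fun w => X w i j) @^-1` `]-oo, r].
  by apply/seteqP; split => w /=; rewrite in_itv.
by rewrite -[_ @^-1` _]setTI; apply: mX.
Qed.

Lemma measurable_forall_links (A : 'I_N -> 'I_N -> set Omega) :
  (forall i j, measurable (A i j)) ->
  measurable [set w | forall i j : 'I_N, i != j -> A i j w].
Proof.
move=> mA.
have -> : [set w | forall i j : 'I_N, i != j -> A i j w] =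
    \bigcap_(i in [set: 'I_N]) \bigcap_(j in [set j | i != j]) A i j.
  apply/seteqP; split => [w Aw i _ j /= ij|w Aw i j ij]; first exact: Aw.
  exact: Aw.
apply: fin_bigcap_measurable => // i _; apply: fin_bigcap_measurable => //.
by apply: (sub_finite_set (B := [set: 'I_N])).

Qed.

Lemma shock_rect_measurable dd (x : lnk R N) : measurable (shock_rect eps dd x).
Proof. by apply: measurable_forall_links => i j; exact: measurable_le_link. Qed.

Lemma hist_rect_measurable m : hist_rect m `<=` measurable.
Proof.
move=> _ [a [b [x ->]]]; apply: measurableI.
  apply: (@measurable_forall_links
    (fun i j => [set w | a0 w i j <= a i j] `&` [set w | b0 w i j <= b i j])) => i j.
  by apply: measurableI; exact: measurable_le_link.
by apply: fin_bigcap_measurable => // dd _; exact: shock_rect_measurable.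
Qed.

Lemma hist_rect_setI m : setI_closed (hist_rect m).
Proof.
move=> _ _ [a [b [x ->]]] [a' [b' [x' ->]]].
exists (fun i j => Num.min (a i j) (a' i j)), (fun i j => Num.min (b i j) (b' i j)),
  (fun dd i j => Num.min (x dd i j) (x' dd i j)).
apply/seteqP; split => [w [[A1 A2] [A3 A4]]|w [A1 A2]].
  split => [i j ij|dd ddm i j ij].
    by rewrite !le_min; have [-> ->] := A1 i j ij; have [-> ->] := A3 i j ij.
  by rewrite le_min (A2 dd ddm i j ij) (A4 dd ddm i j ij).
have B i j : i != j -> [/\ a0 w i j <= a i j, a0 w i j <= a' i j,
    b0 w i j <= b i j & b0 w i j <= b' i j].
  by move=> ij; have [] := A1 i j ij; rewrite !le_min => /andP[? ?] /andP[].
have C dd i j : [set` iota 1 m] dd -> i != j ->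
    eps dd w i j <= x dd i j /\ eps dd w i j <= x' dd i j.
  by move=> ddm ij; have := A2 dd ddm i j ij; rewrite le_min => /andP[].
split; split => [i j /B[]|dd ddm i j ij] //; by have [] := C dd i j ddm ij.
Qed.

(** The upper ends of all ranges give a rectangle that excludes nothing; uniqueness of measures
    requires such a cover. *)
Lemma hist_rectT m : hist_rect m setT.
Proof.
exists (fun _ _ => amax), (fun _ _ => bmax), (fun _ _ _ => ehi).
apply/seteqP; split => // w _; split => [i j ij|dd _ i j ij].
  by have [/andP[_ ->] /andP[_ ->]] := box0 w _ _ ij.
by have /andP[] := eps_rng dd w _ _ ij.
Qed.

(** A sublevel set of one coordinate is a rectangle whose other bounds are the upper ends of the
    ranges. Diagonal coordinates are constantly 0, since rectangles constrain genuine links only. *)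
Lemma hist_coord_measurable m (k : 'I_m.+2 * 'I_N * 'I_N) :
  measurable_fun setT (hist_coord m k : g_sigma_algebraType (hist_rect m) -> R).
Proof.
apply: (measurability _ (RGenOInfty.measurableE R)) => //.
move=> /= _ [_ [r ->] <-]; rewrite setTI.
have -> : hist_coord m k @^-1` `]r, +oo[ = ~` [set w | hist_coord m k w <= r].
  by apply/seteqP; split => w /=; rewrite in_itv/= andbT ltNge; move/negP.
apply: measurableC.
have mb (b : bool) : measurable ([set _ | b] : set (g_sigma_algebraType (hist_rect m))).
  case: b; first by rewrite (_ : [set _ | _] = setT)//; apply/seteqP; split.
  by rewrite (_ : [set _ | _] = set0)//; apply/seteqP; split.
case: k => [[[[|[|t]] tm] i] j]; rewrite /hist_coord/=; case: eqVneq => ij.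
- exact: mb.
- apply: sub_sigma_algebra.
  exists (fun i' j' => if (i' == i) && (j' == j) then r else amax), (fun _ _ => bmax),
    (fun _ _ _ => ehi); apply/seteqP; split => w /=.
    move=> wr; split => [i' j' ij'|dd _ i' j' ij'].
      have [/andP[_ ?] /andP[_ ?]] := box0 w _ _ ij'; split => //.
      by case: ifP => // /andP[/eqP -> /eqP ->].
    by have /andP[] := eps_rng dd w _ _ ij'.
  by move=> [/(_ i j ij)[+ _] _]; rewrite !eqxx.
- exact: mb.
- apply: sub_sigma_algebra.
  exists (fun _ _ => amax), (fun i' j' => if (i' == i) && (j' == j) then r else bmax),
    (fun _ _ _ => ehi); apply/seteqP; split => w /=.
    move=> wr; split => [i' j' ij'|dd _ i' j' ij'].
      have [/andP[_ ?] /andP[_ ?]] := box0 w _ _ ij'; split => //.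
      by case: ifP => // /andP[/eqP -> /eqP ->].
    by have /andP[] := eps_rng dd w _ _ ij'.
  by move=> [/(_ i j ij)[_ +] _]; rewrite !eqxx.
- exact: mb.
apply: sub_sigma_algebra.
exists (fun _ _ => amax), (fun _ _ => bmax),
  (fun dd i' j' => if [&& dd == t.+1, i' == i & j' == j] then r else ehi).
apply/seteqP; split => w /=.
  move=> wr; split => [i' j' ij'|dd _ i' j' ij'].
    by have [/andP[_ ?] /andP[_ ?]] := box0 w _ _ ij'.
  case: ifP => [/and3P[/eqP -> /eqP -> /eqP ->]//|_].
  by have /andP[] := eps_rng dd w _ _ ij'.
move=> [_ /(_ t.+1)] /=; rewrite mem_iota add1n => /(_ _ i j ij); rewrite !eqxx.
by apply; rewrite /= ltnS; rewrite !ltnS in tm.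
Qed.

(** Both sides are finite measures in [A] that agree on the pi-system of rectangles, hence on the
    sigma-algebra it generates. *)
Lemma hist_indep m d (x : lnk R N) (A : set Omega) : (m < d)%N -> <<s hist_rect m >> A ->
  P (A `&` shock_rect eps d x) = (P A * P (shock_rect eps 1 x))%E.
Proof.
move=> md sA.
have d0 : (0 < d)%N by exact: leq_ltn_trans md.
rewrite -(indep.1 d x d0).
have mB := shock_rect_measurable d x.
have fB : P (shock_rect eps d x) \is a fin_num by exact: fin_num_measure.
(* As a nonnegative real, this probability turns the right-hand side into a scaled copy of [P],
   which is again a measure. *)
pose r : {nonneg R} := NngNum (fine_ge0 (measure_ge0 P (shock_rect eps d x))).
  have rE : (r%:num)%:E = P (shock_rect eps d x) by rewrite /r/= fineK.
have ->: (P A * P (shock_rect eps d x))%E = mscale r P A by rewrite muleC -rE.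
rewrite -[LHS]/(mrestr P mB A).
apply: (@g_sigma_algebra_measure_unique _ _ _ (hist_rect m) (@hist_rect_measurable m)
  (fun=> setT)) => //.
- by move=> _; exact: hist_rectT.
- by rewrite bigcup_const//; exists 0%N.
- exact: hist_rect_setI.
- move=> A0 [a [b [y A0E]]].
  change (P (A0 `&` shock_rect eps d x) = ((r%:num)%:E * P A0)%E).
  rewrite rE muleC A0E.
  (* The product rule on the days [1, ..., m, d], distinct because [m < d]; the factor of [d] is
     split off and the rest is folded back by the rule on [1, ..., m]. *)
  have := indep.2 (rcons (iota 1 m) d)
    (fun dd => if (dd == d)%N then x else y dd) a b.
  rewrite rcons_uniq iota_uniq mem_iota add1n ltnS [(d <= m)%N]leqNgt md andbF/= all_rcons d0/=.
  have -> : all (leq 1) (iota 1 m) by apply/allP => z; rewrite mem_iota => /andP[].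
  move=> /(_ isT isT); rewrite big_rcons/= eqxx.
  have := indep.2 (iota 1 m) y a b; rewrite iota_uniq => /(_ isT).
  have -> : all (leq 1) (iota 1 m) by apply/allP => z; rewrite mem_iota => /andP[].
  move=> /(_ isT) ->.
  have nd z : z \in iota 1 m -> (z == d) = false.
    by rewrite mem_iota add1n ltnS => /andP[_ zm]; apply/negbTE; rewrite neq_ltn (leq_ltn_trans zm).
  rewrite (eq_big_seq (fun dd => P (shock_rect eps dd (y dd)))); last first.
    by move=> z /nd ->.
  rewrite muleA => <-; congr (P _).
  rewrite -setIA; congr (_ `&` _); apply/seteqP; split => [w [Aw Bw] z /=|w Aw].
    rewrite mem_rcons inE => /orP[/eqP -> |zm]; first by rewrite eqxx.
    by rewrite nd//; exact: Aw.
  split=> [z /= zm|].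
    by have := Aw z; rewrite /= mem_rcons inE zm orbT nd//; exact.
  by have := Aw d; rewrite /= mem_rcons inE eqxx/=; exact.
- move=> _; change (P (setT `&` shock_rect eps d x) < +oo)%E.
  by rewrite setTI ltey_eq fB.
Qed.

Definition centered (Z : Omega -> R) : Prop :=
  bounded_measurable _ _ _ Z /\ Rintegral P setT Z = 0.

Lemma link_indep m d (i j : 'I_N) (r : R) (A : set Omega) : (m < d)%N -> i != j ->
  <<s hist_rect m >> A ->
  P (A `&` [set w | eps d w i j <= r]) = (P A * P [set w | (eps 1%N w i j <= r)%R])%E.
Proof.
move=> md ij sA.
(* The bound [ehi] leaves the other links unrestricted, so an event on a single link is a shock
   rectangle. *)
pose x : lnk R N := fun i' j' => if (i' == i) && (j' == j) then r else ehi.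
have rE dd : [set w | eps dd w i j <= r] = shock_rect eps dd x.
  apply/seteqP; split => w /=.
    move=> wr i' j' ij'; rewrite /x; case: ifP => [/andP[/eqP -> /eqP ->]//|_].
    by have /andP[] := eps_rng dd w _ _ ij'.
  by move=> /(_ i j ij); rewrite /x !eqxx.
by rewrite !rE; exact: hist_indep sA.
Qed.

Lemma Rintegral_indic (A : set Omega) : measurable A ->
  Rintegral P setT (\1_A : Omega -> R) = fine (P A).
Proof. by move=> mA; rewrite /Rintegral integral_indic// setIT. Qed.

Lemma indic_le (Z : Omega -> R) (x : R) (w : Omega) :
  (Z w <= x)%R%:R = \1_[set v | Z v <= x] w :> R.
Proof. by rewrite indicE; congr (nat_of_bool _)%:R; apply/idP/idP; rewrite inE. Qed.

(** [mean_mul_eq_cdf] is used twice: first to pass from distribution functions of the shock to its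
    mean on a past event, then to pass from past events to the past variable [g]. *)
Lemma shock_centered m d (i j : 'I_N) (g : Omega -> R) : (m < d)%N -> i != j ->
  (exists C : R, forall w, `|g w| <= C) ->
  (forall w, g @ hist_nbhs m w --> g w) ->
  centered (fun w => eps d w i j * g w).
Proof.
move=> md ij [C gC] cg.
have mg : measurable_fun setT (g : g_sigma_algebraType (hist_rect m) -> R).
  exact: nearby_measurable (hist_coord_measurable m) cg.
have sm : <<s hist_rect m >> `<=` measurable.
  by apply: smallest_sub; [exact: sigma_algebra_measurable|exact: hist_rect_measurable].
have mg' : measurable_fun setT g.
  by move=> _ B mB; apply: sm; have := mg measurableT B mB.
have beps dd : bounded_measurable _ _ _ (fun w => eps dd w i j).
  split; first exact: eps_meas.
  exists (`|elo| + `|ehi|) => w; have /andP[? ?] := eps_rng dd w _ _ ij.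
  have := ler_norm ehi; have := ler_norm (- elo); rewrite normrN ler_norml.
  by have := normr_ge0 ehi; have := normr_ge0 elo; lra.
have bg : bounded_measurable _ _ _ g by split => //; exists C.
split; first exact: bounded_measurableM.
have bind (A : set Omega) : measurable A -> bounded_measurable _ _ _ (\1_A : Omega -> R).
  move=> mA; split; first exact: measurable_indic.
  by exists 1 => w; rewrite indicE; case: (_ \in _); rewrite ?normr1 ?normr0.
have mle (Z : Omega -> R) x : measurable_fun setT Z -> measurable [set w | Z w <= x].
  move=> mZ; have -> : [set w | Z w <= x] = Z @^-1` `]-oo, x].
    by apply/seteqP; split => w /=; rewrite in_itv.
  by rewrite -[_ @^-1` _]setTI; apply: mZ.
have mean_on_past0 (A : set Omega) : <<s hist_rect m >> A ->
    Rintegral P setT (fun w => \1_A w * eps d w i j) = 0.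
  move=> sA; have mA := sm _ sA.
  (* By independence the indicator may be replaced by the constant [P A], and the shock by that of
     day 1, whose mean is 0. *)
  rewrite (@mean_mul_eq_cdf _ _ _ P (\1_A) (fun=> fine (P A)) _ (fun w => eps 1%N w i j) elo ehi)//.
  - by rewrite meanZ// /Rintegral eps_mean// mulr0.
  - exact: bind.
  - exact: bounded_measurable_cst.
  - by move=> w; exact: eps_rng.
  - by move=> w; exact: eps_rng.
  move=> x; rewrite meanZ; last by apply: bounded_measurable_le.
  have il dd w : (eps dd w i j <= x)%R%:R = \1_[set v | eps dd v i j <= x] w :> R.
    exact: (indic_le (fun w => eps dd w i j)).
  have -> : (fun w => \1_A w * (eps d w i j <= x)%R%:R) =
      \1_(A `&` [set w | eps d w i j <= x]) :> (Omega -> R).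
    by apply/funext => w; rewrite il indicI.
  have -> : (fun w => (eps 1%N w i j <= x)%R%:R) =
      \1_[set w | eps 1%N w i j <= x] :> (Omega -> R).
    by apply/funext => w; rewrite il.
  rewrite !Rintegral_indic//; last 2 first.
  - exact: mle.
  - by apply: measurableI => //; exact: mle.
  by rewrite (link_indep _ _ _ _ _ _ md ij sA) fineM// fin_num_measure//; exact: mle.
(* The roles are now exchanged: the shock is the weight, [g] is approximated, and the weight
   compared with is 0. *)
rewrite (@mean_mul_eq_cdf _ _ _ P _ (fun=> 0) g g (- C) C)//.
- by rewrite meanZ// mul0r.
- exact: bounded_measurable_cst.
- by move=> w; have := gC w; rewrite ler_norml.
- by move=> w; have := gC w; rewrite ler_norml.
move=> x; rewrite meanZ ?mul0r; last exact: bounded_measurable_le.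
under eq_fun do rewrite mulrC indic_le.
apply: mean_on_past0.
have -> : [set w | g w <= x] = setT `&` g @^-1` `]-oo, x].
  by rewrite setTI; apply/seteqP; split => w /=; rewrite in_itv.
by apply: mg.
Qed.

Lemma centeredD Z1 Z2 : centered Z1 -> centered Z2 -> centered (fun w => Z1 w + Z2 w).
Proof. by move=> [b1 e1] [b2 e2]; split; [exact: bounded_measurableD|rewrite meanD// e1 e2 addr0]. Qed.

Lemma centeredZ (a : R) Z : centered Z -> centered (fun w => a * Z w).
Proof.
move=> [b e]; split; first by apply: bounded_measurableM => //; exact: bounded_measurable_cst.
by rewrite meanZ// e mulr0.
Qed.

Lemma centered0 : centered (fun=> 0).
Proof. by split; [exact: bounded_measurable_cst|rewrite mean_cst]. Qed.

Lemma centered_sum (I : eqType) (s : seq I) (p : pred I) (Z : I -> Omega -> R) :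
  (forall i, i \in s -> p i -> centered (Z i)) ->
  centered (fun w => \sum_(i <- s | p i) Z i w).
Proof.
elim: s => [|i s IH] cZ.
  by under [X in centered X]eq_fun do rewrite big_nil; exact: centered0.
have cs : centered (fun w => \sum_(i <- s | p i) Z i w).
  by apply: IH => k ks; apply: cZ; rewrite inE ks orbT.
case pi: (p i); under [X in centered X]eq_fun do rewrite big_cons pi; last exact: cs.
by apply: centeredD => //; apply: cZ; rewrite ?mem_head.
Qed.

(* No measurability of [f] is needed: the integrals of its positive and negative
   parts are suprema, hence monotone. *)
Lemma integral_le_centered (f Z : Omega -> R) (k : R) : centered Z ->
  (forall w, f w <= k + Z w) -> (\int[P]_w (f w)%:E <= k%:E)%E.
Proof.
move=> [bZ eZ] fk; pose U w := k + Z w.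
have bU : bounded_measurable _ _ _ U by apply: bounded_measurableD => //; exact: bounded_measurable_cst.
have -> : k%:E = (\int[P]_w (U w)%:E)%E.
  have := bounded_measurable_integrable _ _ _ P _ bU => /(integrable_fin_num measurableT) /= /fineK <-.
  by congr _%:E; rewrite -[RHS]/(Rintegral P setT U) meanD ?mean_cst ?eZ ?addr0//; exact: bounded_measurable_cst.
have le_ge0 (g1 g2 : Omega -> \bar R) : (forall w, 0 <= g1 w)%E ->
    (forall w, g1 w <= g2 w)%E -> (\int[P]_w g1 w <= \int[P]_w g2 w)%E.
  move=> g10 g12; rewrite !ge0_integralTE//; last first.
    by move=> w; exact: le_trans (g12 w).
  apply: le_ereal_sup => _ [h hg <-]; exists h => // w.
  exact: le_trans (g12 w).
rewrite integralE [leRHS]integralE; apply: leeB; apply: le_ge0 => // w.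
  rewrite !funeposE; apply: le_max2 => //; rewrite lee_fin; exact: fk.
rewrite !funenegE; apply: le_max2 => //; rewrite leeN2 lee_fin; exact: fk.
Qed.
End History.

(** * Optimal prices *)

Section LinkSums.
Variables (R : realType) (N : nat).
Implicit Types F G p a b mu xi em : lnk R N.

Definition link_sum F : R := \sum_(i < N) \sum_(j < N | j != i) F i j.

Lemma eq_link_sum F G : (forall i j : 'I_N, i != j -> F i j = G i j) ->
  link_sum F = link_sum G.
Proof.
by move=> FG; apply: eq_bigr => i _; apply: eq_bigr => j; rewrite eq_sym; exact: FG.
Qed.

Lemma link_sumD F G : link_sum (fun i j => F i j + G i j) = link_sum F + link_sum G.
Proof. by rewrite /link_sum -big_split; apply: eq_bigr => i _; rewrite big_split. Qed.

Lemma link_sumZ (k : R) F : link_sum (fun i j => k * F i j) = k * link_sum F.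
Proof. by rewrite /link_sum mulr_sumr; apply: eq_bigr => i _; rewrite mulr_sumr. Qed.

Lemma link_sumB F G : link_sum (fun i j => F i j - G i j) = link_sum F - link_sum G.
Proof.
by rewrite -mulN1r -link_sumZ -link_sumD; apply: eq_link_sum => i j _; rewrite mulN1r.
Qed.

Lemma le_link_sum F G : (forall i j : 'I_N, i != j -> F i j <= G i j) ->
  link_sum F <= link_sum G.
Proof.
by move=> FG; apply: ler_sum => i _; apply: ler_sum => j; rewrite eq_sym; exact: FG.
Qed.

Lemma link_sum_ge0 F : (forall i j : 'I_N, i != j -> 0 <= F i j) -> 0 <= link_sum F.
Proof.
by move=> F0; apply: sumr_ge0 => i _; apply: sumr_ge0 => j; rewrite eq_sym; exact: F0.
Qed.

Lemma link_sum_term F (i j : 'I_N) : (forall k l : 'I_N, k != l -> 0 <= F k l) ->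
  i != j -> F i j <= link_sum F.
Proof.
move=> F0 ij; rewrite /link_sum (bigD1 i)//= (bigD1 j)/=; last by rewrite eq_sym.
rewrite -addrA lerDl addr_ge0//.
  by apply: sumr_ge0 => k /andP[ki _]; apply: F0; rewrite eq_sym.
by apply: sumr_ge0 => k _; apply: sumr_ge0 => l; rewrite eq_sym; exact: F0.
Qed.

(** Summation by parts: multipliers at the nodes act on a flow through potential differences along
    the links. *)
Lemma sum_flow_res a b p (lam : 'I_N -> R) :
  \sum_(i < N) lam i * flow_res a b p i =
  link_sum (fun i j => (lam i - lam j) * (a i j - b i j * p i j)).
Proof.
under eq_bigr do rewrite /flow_res mulrBr.
rewrite sumrB; under eq_bigr do rewrite mulr_sumr.
under [X in _ - X]eq_bigr do rewrite mulr_sumr.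
rewrite [X in _ - X](exchange_big_dep xpredT)//= -sumrB; apply: eq_bigr => i _.
have -> : \sum_(j < N | j != i) (lam i - lam j) * (a i j - b i j * p i j) =
   \sum_(j < N | j != i) lam i * (a i j - b i j * p i j)
   - \sum_(j < N | j != i) lam j * (a i j - b i j * p i j).
  by rewrite -sumrB; apply: eq_bigr => j _; rewrite mulrBl.
by congr (_ - _); apply: eq_bigl => j; rewrite eq_sym.
Qed.

Lemma objE xi em (c : R) a b p : obj xi em c a b p = link_sum (fun i j =>
  xi i j * (a i j - b i j * p i j + em i j) * p i j - xi i j * (a i j - b i j * p i j) * c).
Proof. by rewrite link_sumB. Qed.

Definition lagr_link xi em (c pmax : R) a b (lam : 'I_N -> R) mu p : lnk R N := fun i j =>
  xi i j * (a i j - b i j * p i j + em i j) * p i j - xi i j * (a i j - b i j * p i j) * c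
  + (lam i - lam j) * (a i j - b i j * p i j) + mu i j * (pmax - p i j).

Lemma lagrE xi em (c pmax : R) a b (lam : 'I_N -> R) mu p :
  lagr xi em c pmax a b lam mu p = link_sum (lagr_link xi em c pmax a b lam mu p).
Proof. by rewrite /lagr objE sum_flow_res -!link_sumD. Qed.

(** This extracts a first-order condition without derivatives: for small [s] the linear term
    dominates. *)
Lemma ge0_linear_coef (L K : R) : (forall s, 0 < s -> 0 <= s * L + s ^+ 2 * K) -> 0 <= L.
Proof.
move=> H; rewrite leNgt; apply/negP => L0.
have K1 : 0 < `|K| + 1 by rewrite ltr_wpDl.
pose s := - L / (2 * (`|K| + 1)).
have s0 : 0 < s by rewrite divr_gt0 ?oppr_gt0// mulr_gt0.
have := H s s0; rewrite expr2 -mulrA -mulrDr pmulr_rge0// leNgt => /negP; apply.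
have sE : s * (`|K| + 1) = - L / 2.
  by rewrite /s; field; rewrite gt_eqF.
have : s * K <= s * (`|K| + 1).
  by rewrite ler_pM2l// (le_trans (ler_norm K))// lerDl.
by rewrite sE; lra.
Qed.

(** Balance plus stationarity of the Lagrangian in each price with zero cap multipliers. The cap
    itself is left out, so that two such systems can be subtracted. *)
Definition kkt xi em (c : R) a b p : Prop :=
  (forall i : 'I_N, flow_res a b p i = 0) /\
  exists lam : 'I_N -> R, forall i j : 'I_N, i != j ->
    xi i j * (a i j + em i j - 2 * b i j * p i j + b i j * c) = b i j * (lam i - lam j).

(** The maximiser [q] of the Lagrangian at the dual optimum is feasible, by optimality of the dual
    variables. Strict concavity then identifies it with the optimal [p]. *)
Lemma zero_cap_kkt xi em (c pmax : R) a b p :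
  (forall i j : 'I_N, i != j -> 0 < xi i j) -> (forall i j : 'I_N, i != j -> 0 < b i j) ->
  is_opt xi em c pmax a b p -> zero_cap_dual xi em c pmax a b -> kkt xi em c a b p.
Proof.
move=> xi0 b0 [[pflow pcap] popt] [lam [mu [[_ dopt] mu0]]].
(* The Lagrangian separates over links into concave quadratics; [q] collects their vertices. *)
pose q : lnk R N := fun i j =>
  (xi i j * (a i j + em i j + b i j * c) - b i j * (lam i - lam j)) / (2 * xi i j * b i j).
have qE i j : i != j -> xi i j * (a i j + em i j + b i j * c) =
    b i j * (lam i - lam j) + 2 * xi i j * b i j * q i j.
  by move=> ij; rewrite /q; field; rewrite !gt_eqF ?xi0 ?b0.
have quad i j p' : i != j -> lagr_link xi em c pmax a b lam mu p' i j =
    lagr_link xi em c pmax a b lam mu q i j - xi i j * b i j * (p' i j - q i j) ^+ 2.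
  move=> ij; rewrite /lagr_link mu0//.
  have := qE i j ij => e.
  have : (p' i j - q i j) * (xi i j * (a i j + em i j + b i j * c)
      - (b i j * (lam i - lam j) + 2 * xi i j * b i j * q i j)) = 0 by rewrite e subrr mulr0.
  by move=> e'; apply/eqP; rewrite -subr_eq0 -[X in _ == X]e'; apply/eqP; ring.
(* The one-sided derivative of the dual function in the direction [(y, m)] is nonnegative; [m] must
   be nonnegative because the cap multipliers start from 0. *)
have pert (y : 'I_N -> R) (m : lnk R N) : (forall i j : 'I_N, i != j -> 0 <= m i j) ->
    0 <= link_sum (fun i j => (y i - y j) * (a i j - b i j * q i j) + m i j * (pmax - q i j)).
  move=> m0.
  (* The second-order gain of the perturbed Lagrangian: maximise
     [- xi b t^2 - s (b (y i - y j) + m) t] over the displacement [t] from [q]. *)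
  pose K := link_sum (fun i j => (b i j * (y i - y j) + m i j) ^+ 2 / (4 * xi i j * b i j)).
  apply: (@ge0_linear_coef _ K) => s s0.
  pose lam' i := lam i + s * y i; pose mu' : lnk R N := fun i j => s * m i j.
  have fmu' : dual_feas mu' by move=> i j ij; rewrite /mu'; apply: mulr_ge0; [exact: ltW|exact: m0].
  have := dopt lam' mu' fmu'.
  set L := link_sum _ => le1.
  have : ((lagr xi em c pmax a b lam mu q)%:E <=
          (lagr xi em c pmax a b lam mu q + (s * L + s ^+ 2 * K))%:E)%E.
    have lb : ((lagr xi em c pmax a b lam mu q)%:E <= dualfun xi em c pmax a b lam mu)%E.
      by apply: ereal_sup_ubound; exists q.
    apply: (le_trans lb); apply: (le_trans le1); apply: ge_ereal_sup => _ [p' _ <-]; rewrite lee_fin.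
    rewrite !lagrE -!link_sumZ -!link_sumD; apply: le_link_sum => i j ij.
    have -> : lagr_link xi em c pmax a b lam' mu' p' i j = lagr_link xi em c pmax a b lam mu p' i j
      + s * ((y i - y j) * (a i j - b i j * p' i j) + m i j * (pmax - p' i j)).
      by rewrite /lagr_link /lam' /mu' mu0//; ring.
    rewrite quad// -addrA lerD2l.
    have xb : 0 < xi i j * b i j by rewrite mulr_gt0 ?xi0 ?b0.
    have xx : xi i j != 0 by rewrite gt_eqF ?xi0.
    have bb : b i j != 0 by rewrite gt_eqF ?b0.
    rewrite -subr_ge0.
    rewrite [X in 0 <= X](_ : _ = xi i j * b i j * ((p' i j - q i j) +
      s * (b i j * (y i - y j) + m i j) / (2 * xi i j * b i j)) ^+ 2); last first.
      by field; rewrite xx bb.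
    by rewrite mulr_ge0 ?sqr_ge0// ltW.
  by rewrite lee_fin lerDl.
(* Testing in the direction of minus the residuals bounds the sum of their squares by 0. *)
have qflow i : flow_res a b q i = 0.
  have := pert (fun i => - flow_res a b q i) (fun _ _ => 0) (fun _ _ _ => lexx 0).
  under eq_link_sum do rewrite mul0r addr0.
  rewrite -sum_flow_res; under eq_bigr do rewrite mulNr -expr2.
  rewrite sumrN oppr_ge0 => le0.
  apply/eqP; rewrite -sqrf_eq0 eq_le sqr_ge0 andbT; apply: le_trans le0.
  by rewrite (bigD1 i)//= lerDl sumr_ge0// => k _; exact: sqr_ge0.
(* The direction is the indicator of a single cap multiplier. *)
have qcap i j : i != j -> q i j <= pmax.
  move=> ij.
  pose m : lnk R N := fun i' j' => ((i' == i) && (j' == j))%:R.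
  have := pert (fun=> 0) m (fun _ _ _ => ler0n _ _).
  rewrite /link_sum (bigD1 i)//= (bigD1 j)/=; last by rewrite eq_sym.
  have mN k l : (k == i) && (l == j) = false ->
      (0 - 0) * (a k l - b k l * q k l) + m k l * (pmax - q k l) = 0.
    by rewrite /m => ->; rewrite subrr !mul0r addr0.
  rewrite [X in _ + _ + X]big1; last first.
    by move=> k ki; rewrite big1// => l _; rewrite mN// (negbTE ki).
  rewrite big1; last by move=> l /andP[_ lj]; rewrite mN// (negbTE lj) andbF.
  by rewrite !addr0 subrr mul0r add0r /m !eqxx/= mulr1n mul1r subr_ge0.
(* Among balanced prices the objective equals the Lagrangian, so optimality of [p] against [q]
   forces the squares in [quad] to vanish. *)
have := popt q (conj qflow qcap).
have lagrq p' : (forall i, flow_res a b p' i = 0) ->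
    obj xi em c a b p' = link_sum (lagr_link xi em c pmax a b lam mu p').
  move=> fp'; rewrite -lagrE /lagr big1 => [|i _]; last by rewrite fp' mulr0.
  rewrite big1 ?addr0// => i _; rewrite big1// => j; rewrite eq_sym => ij.
  by rewrite mu0// mul0r.
rewrite !lagrq// (eq_link_sum _ _ (fun i j ij => quad i j p ij)) link_sumB.
rewrite lerBrDl gerDr => le0.
have sq0 i j : i != j -> 0 <= xi i j * b i j * (p i j - q i j) ^+ 2.
  by move=> ij; rewrite mulr_ge0 ?sqr_ge0// mulr_ge0// ltW ?xi0 ?b0.
have pq i j : i != j -> p i j = q i j.
  move=> ij; have := le_trans (link_sum_term _ _ _ sq0 ij) le0.
  rewrite pmulr_rle0 ?mulr_gt0 ?xi0 ?b0// => h; apply/eqP.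
  by rewrite -subr_eq0 -sqrf_eq0 eq_le h sqr_ge0.
split=> //; exists lam => i j ij.
by have := qE i j ij; rewrite pq//; lra.
Qed.

(** The constant depends on the base point [a], [b], [p] but not on [p'], so it needs no prior bound
    on the perturbed prices. The base point is the true parameters for the regret, and a realised
    estimate for continuity in the history. *)
Lemma kkt_lipschitz xi em (c amin amax bmin bmax : R) a b p :
  (forall i j : 'I_N, i != j -> 0 < xi i j) -> 0 < bmin ->
  in_box amin amax bmin bmax a b -> kkt xi em c a b p ->
  exists2 K : R, 0 < K & forall a' b' p' : lnk R N,
    in_box amin amax bmin bmax a' b' -> kkt xi em c a' b' p' ->
    forall i j : 'I_N, i != j -> `|p' i j - p i j| <=
      K * link_sum (fun i j => `|a' i j - a i j| + `|b' i j - b i j|).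
Proof.
move=> xi0 bm0 box [fl [lam lamE]].
(* A crude common bound: all summands are nonnegative, so [B] dominates each of the coefficients of
   the parameter errors on every link. *)
pose B := link_sum (fun i j => 1 + `|p i j| + `|a i j + em i j| / bmin ^+ 2 + bmin^-1).
pose Xi := link_sum (fun i j => (xi i j)^-1).
pose S := link_sum xi.
have B0 : 0 <= B.
  by apply: link_sum_ge0 => i j _; rewrite !addr_ge0// ?divr_ge0// ?exprn_ge0 ?invr_ge0 ?ltW.
(* The product of the constants in [low] and [up] below; the 1 added after the root keeps the
   Lipschitz constant positive. *)
pose K2 := Xi / bmin * (S * (B ^+ 2 / bmin + bmax * B ^+ 2)).
exists (Num.sqrt K2 + 1); first by rewrite ltr_wpDl// sqrtr_ge0.
move=> a' b' p' box' [fl' [lam' lamE']] i0 j0 ij0.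
set e := link_sum _.
have e_ge0 : 0 <= e by apply: link_sum_ge0 => i j _; rewrite addr_ge0.
pose pi : lnk R N := fun i j => p' i j - p i j.
(* [f] is the change of flow at unchanged prices, so the full change is [f - b' * pi]. [g] is the
   shift of the price at which stationarity holds with unchanged potentials. *)
pose f : lnk R N := fun i j => (a' i j - a i j) - (b' i j - b i j) * p i j.
pose g : lnk R N := fun i j =>
  2^-1 * ((a' i j + em i j) / b' i j - (a i j + em i j) / b i j).
have b'0 i j : i != j -> 0 < b' i j.
  by move=> /box'[_ /andP[+ _]]; exact: lt_le_trans.
have b0 i j : i != j -> 0 < b i j.
  by move=> /box[_ /andP[+ _]]; exact: lt_le_trans.
have BT i j : i != j -> 1 + `|p i j| + `|a i j + em i j| / bmin ^+ 2 + bmin^-1 <= B.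
  move=> ij; apply: (link_sum_term (fun i j => 1 + `|p i j| + `|a i j + em i j| / bmin ^+ 2 + bmin^-1)) ij.
  by move=> k l _; rewrite !addr_ge0// ?divr_ge0// ?exprn_ge0 ?invr_ge0 ?ltW.
have eT i j : i != j -> `|a' i j - a i j| + `|b' i j - b i j| <= e.
  move=> ij; apply: (link_sum_term (fun i j => `|a' i j - a i j| + `|b' i j - b i j|)) ij.
  by move=> k l _; rewrite addr_ge0.
have fB i j : i != j -> f i j ^+ 2 <= (B * e) ^+ 2.
  move=> ij; rewrite -real_normK ?num_real// ler_sqr ?nnegrE ?mulr_ge0//.
  rewrite /f (le_trans (ler_normB _ _))// normrM.
  have h1 : 1 <= B.
    apply: le_trans (BT i j ij); rewrite -!addrA lerDl !addr_ge0// ?divr_ge0// ?exprn_ge0 ?invr_ge0 ?ltW//.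
  have h2 : `|p i j| <= B.
    apply: le_trans (BT i j ij).
    have : 0 <= `|a i j + em i j| / bmin ^+ 2 by rewrite divr_ge0// exprn_ge0// ltW.
    have : 0 <= bmin^-1 by rewrite invr_ge0 ltW.
    lra.
  apply: le_trans (ler_wpM2l B0 (eT i j ij)); rewrite mulrDr lerD//.
    by rewrite ler_peMl.
  by rewrite mulrC ler_wpM2r.
have gB i j : i != j -> g i j ^+ 2 <= (B * e) ^+ 2.
  move=> ij; rewrite -real_normK ?num_real// ler_sqr ?nnegrE ?mulr_ge0//.
  have b1 := b0 i j ij; have b1' := b'0 i j ij.
  have [_ /andP[bb _]] := box i j ij; have [_ /andP[bb' _]] := box' i j ij.
  have -> : g i j = 2^-1 * ((a' i j - a i j) / b' i j
     - (a i j + em i j) / (b i j * b' i j) * (b' i j - b i j)).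
    by rewrite /g; field; rewrite !gt_eqF.
  have n1 : `|(a' i j - a i j) / b' i j| <= bmin^-1 * `|a' i j - a i j|.
    rewrite normrM mulrC ler_wpM2r// ger0_norm; last by rewrite invr_ge0 ltW.
    by rewrite lef_pV2.
  have n2 : `|(a i j + em i j) / (b i j * b' i j) * (b' i j - b i j)| <=
      `|a i j + em i j| / bmin ^+ 2 * `|b' i j - b i j|.
    rewrite !normrM ler_wpM2r// ler_wpM2l// ger0_norm; last first.
      by rewrite invr_ge0 mulr_ge0// ltW.
    by rewrite lef_pV2 ?posrE ?exprn_gt0 ?mulr_gt0// expr2 ler_pM// ltW.
  rewrite normrM (le_trans (ler_wpM2l (normr_ge0 _) (ler_normB _ _)))//.
  have h0 : `|2^-1| <= 1 :> R by rewrite ger0_norm; lra.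
  apply: (le_trans (ler_wpM2r _ h0)); first by rewrite addr_ge0.
  rewrite mul1r (le_trans (lerD n1 n2))//.
  apply: le_trans (ler_wpM2l B0 (eT i j ij)); rewrite mulrDr.
  have p0 := normr_ge0 (p i j).
  have q0 : 0 <= `|a i j + em i j| / bmin ^+ 2 by rewrite divr_ge0// exprn_ge0// ltW.
  have r0 : 0 <= bmin^-1 by rewrite invr_ge0 ltW.
  by apply: lerD; apply: ler_wpM2r => //; apply: le_trans (BT i j ij); lra.
(* The difference of two balanced flows is orthogonal to every potential difference. *)
have orth (l : 'I_N -> R) :
    link_sum (fun i j => (l i - l j) * (f i j - b' i j * pi i j)) = 0.
  have := sum_flow_res a' b' p' l; rewrite big1 => [|i _]; last by rewrite fl' mulr0.
  have := sum_flow_res a b p l; rewrite big1 => [|i _]; last by rewrite fl mulr0.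
  move=> e1 e2; rewrite -[RHS]subr0 {1}e2 e1 -link_sumB; apply: eq_link_sum => i j _.
  by rewrite /f /pi; ring.
(* By stationarity the potential differences change by [2 * xi * (g - pi)]; [orth] is applied to
   this change. *)
have key : link_sum (fun i j => xi i j * (g i j - pi i j) * (f i j - b' i j * pi i j)) = 0.
  have := orth (fun i => lam' i - lam i) => o.
  rewrite -[RHS](mulr0 2^-1) -[in RHS]o -link_sumZ; apply: eq_link_sum => i j ij.
  have b1 := b0 i j ij; have b1' := b'0 i j ij.
  have l1 : lam i - lam j = xi i j * ((a i j + em i j) / b i j - 2 * p i j + c).
    apply: (@mulfI _ (b i j)); first by rewrite gt_eqF.
    by rewrite -lamE//; field; rewrite gt_eqF.
  have l2 : lam' i - lam' j = xi i j * ((a' i j + em i j) / b' i j - 2 * p' i j + c).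
    apply: (@mulfI _ (b' i j)); first by rewrite gt_eqF.
    by rewrite -lamE'//; field; rewrite gt_eqF.
  have -> : lam' i - lam i - (lam' j - lam j) = (lam' i - lam' j) - (lam i - lam j) by ring.
  by rewrite l1 l2 /g /pi; field; rewrite !gt_eqF.
(* The right side minus the left, plus twice [key], is the sum of
   [xi / b' * (f + b' * g - b' * pi)^2]. *)
have main : link_sum (fun i j => xi i j * b' i j * pi i j ^+ 2) <=
    link_sum (fun i j => xi i j * (f i j ^+ 2 / b' i j + b' i j * g i j ^+ 2)).
  have := congr1 ( *%R 2) key; rewrite mulr0 -link_sumZ => key2.
  rewrite -subr_ge0 -link_sumB -[X in 0 <= X]addr0 -[X in _ + X]key2 -link_sumD.
  apply: link_sum_ge0 => i j ij.
  have b1' := b'0 i j ij.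
  rewrite [X in 0 <= X](_ : _ = xi i j * (b' i j)^-1 * (f i j + b' i j * g i j - b' i j * pi i j) ^+ 2
     + 0); last first.
    by field; rewrite gt_eqF.
  by rewrite addr0 mulr_ge0 ?sqr_ge0// mulr_ge0 ?invr_ge0// ltW ?xi0.
have up : link_sum (fun i j => xi i j * (f i j ^+ 2 / b' i j + b' i j * g i j ^+ 2)) <=
    S * (B ^+ 2 / bmin + bmax * B ^+ 2) * e ^+ 2.
  have -> : S * (B ^+ 2 / bmin + bmax * B ^+ 2) * e ^+ 2 =
      link_sum (fun i j => (B ^+ 2 / bmin + bmax * B ^+ 2) * e ^+ 2 * xi i j).
    by rewrite link_sumZ -/S; ring.
  apply: le_link_sum => i j ij.
  have b1' := b'0 i j ij; have [_ /andP[bb' bb'']] := box' i j ij.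
  rewrite mulrC; apply: ler_wpM2r; first exact/ltW/xi0.
  rewrite mulrDl; apply: lerD.
    have -> : B ^+ 2 / bmin * e ^+ 2 = (B * e) ^+ 2 / bmin by ring.
    apply: ler_pM; [exact: sqr_ge0| |exact: fB|by rewrite lef_pV2].
    by rewrite invr_ge0 ltW.
  have -> : bmax * B ^+ 2 * e ^+ 2 = bmax * (B * e) ^+ 2 by ring.
  by apply: ler_pM; [exact: ltW|exact: sqr_ge0|by []|exact: gB].
have low : pi i0 j0 ^+ 2 <= Xi / bmin * link_sum (fun i j => xi i j * b' i j * pi i j ^+ 2).
  have xpos := xi0 i0 j0 ij0; have b1' := b'0 i0 j0 ij0.
  have [_ /andP[bb' _]] := box' i0 j0 ij0.
  have t0 k l : k != l -> 0 <= xi k l * b' k l * pi k l ^+ 2.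
    by move=> kl; rewrite mulr_ge0 ?sqr_ge0// mulr_ge0// ltW// ?xi0// b'0.
  have T := link_sum_term _ _ _ t0 ij0.
  have XT : (xi i0 j0)^-1 <= Xi.
    apply: (link_sum_term (fun i j => (xi i j)^-1)) => // k l kl.
    by rewrite invr_ge0 ltW// xi0.
  have -> : pi i0 j0 ^+ 2 = (xi i0 j0)^-1 / b' i0 j0 * (xi i0 j0 * b' i0 j0 * pi i0 j0 ^+ 2).
    by field; rewrite !gt_eqF.
  apply: ler_pM => //; [|exact: t0|].
    by rewrite mulr_ge0// invr_ge0 ltW.
  apply: ler_pM => //; last by rewrite lef_pV2.
    by rewrite invr_ge0 ltW.
  by rewrite invr_ge0 ltW.
have XB0 : 0 <= Xi / bmin.
  rewrite mulr_ge0 ?invr_ge0 ?(ltW bm0)//; apply: link_sum_ge0 => i j ij.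
  by rewrite invr_ge0 ltW// xi0.
have : pi i0 j0 ^+ 2 <= K2 * e ^+ 2.
  apply: (le_trans low).
  have -> : K2 * e ^+ 2 = Xi / bmin * (S * (B ^+ 2 / bmin + bmax * B ^+ 2) * e ^+ 2).
    by rewrite /K2; ring.
  apply: ler_wpM2l => //.
  exact: le_trans main up.
move=> pK; have K20 : 0 <= K2.
  rewrite /K2; apply: mulr_ge0 => //; apply: mulr_ge0.
    by apply: link_sum_ge0 => i j ij; rewrite ltW// xi0.
  have [_ /andP[h1 h2]] := box i0 j0 ij0.
  have bM : 0 <= bmax by apply: le_trans (le_trans h1 h2); exact: ltW.
  by rewrite addr_ge0// mulr_ge0// ?sqr_ge0// invr_ge0 ltW.
rewrite -/(pi i0 j0); apply: (@le_trans _ _ (Num.sqrt K2 * e)).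
  rewrite -ler_sqr ?nnegrE ?mulr_ge0 ?sqrtr_ge0// exprMn sqr_sqrtr//.
  by rewrite real_normK ?num_real.
by rewrite ler_wpM2r// lerDl.
Qed.
End LinkSums.

(** * Least squares *)

Section LeastSquares.
Variables (R : realType) (x e : nat -> R).

Definition sum_upto (f : nat -> R) (t : nat) : R := \sum_(1 <= tau < t.+1) f tau.

Lemma sum_uptoS f t : sum_upto f t.+1 = sum_upto f t + f t.+1.
Proof. by rewrite /sum_upto big_nat_recr. Qed.

Lemma sum_upto0 f : sum_upto f 0 = 0.
Proof. by rewrite /sum_upto big_geq. Qed.

Let sx := sum_upto x.
Let sxx := sum_upto (fun tau => x tau ^+ 2).
Let se := sum_upto e.
Let sxe := sum_upto (fun tau => x tau * e tau).

Definition gram_det (t : nat) : R :=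
  t%:R * sum_upto (fun tau => x tau ^+ 2) t - sum_upto x t ^+ 2.

(* The self-normalised noise S^T V^-1 S, with S = sum_tau e_tau z_tau,
   V = sum_tau z_tau z_tau^T and z_tau = (1, x_tau). *)
Definition normalized_noise (t : nat) : R :=
  let sx := sum_upto x t in let sxx := sum_upto (fun tau => x tau ^+ 2) t in
  let se := sum_upto e t in let sxe := sum_upto (fun tau => x tau * e tau) t in
  (sxx * se ^+ 2 - 2 * sx * se * sxe + t%:R * sxe ^+ 2) / gram_det t.

(* z_(t+1)^T V_(t+1)^-1 S_t; it only involves e_1, .., e_t. *)
Definition noise_gain (t : nat) : R :=
  let sx := sum_upto x t in let sxx := sum_upto (fun tau => x tau ^+ 2) t in
  let se := sum_upto e t in let sxe := sum_upto (fun tau => x tau * e tau) t in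
  (sxx * se - sx * x t.+1 * se - sx * sxe + t%:R * x t.+1 * sxe) / gram_det t.+1.

Lemma gram_detS t : gram_det t.+1 =
  gram_det t + (sxx t - 2 * sx t * x t.+1 + t%:R * x t.+1 ^+ 2).
Proof. by rewrite /gram_det /sx /sxx !sum_uptoS -natr1; ring. Qed.

(** The increment is [z^T adj(V) z] for [z = (1, x t.+1)], positive because [V] is positive
    definite. *)
Lemma gram_step_gt0 t : (0 < t)%N -> 0 < gram_det t ->
  0 < sxx t - 2 * sx t * x t.+1 + t%:R * x t.+1 ^+ 2.
Proof.
move=> t0 D0; have t0' : 0 < t%:R :> R by rewrite ltr0n.
rewrite -(pmulr_rgt0 _ t0').
rewrite [X in 0 < X](_ : _ = (t%:R * x t.+1 - sx t) ^+ 2 + gram_det t).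
  by rewrite ltr_wpDl// sqr_ge0.
by rewrite /gram_det -/sx -/sxx -/(sx t) -/(sxx t); ring.
Qed.

Lemma gram_det_gt0 t : 0 < gram_det 2 -> (2 <= t)%N -> 0 < gram_det t.
Proof.
move=> D2; elim: t => // t IH; rewrite leq_eqVlt => /predU1P[<-//|t2].
have t0 : (0 < t)%N by lia.
by rewrite gram_detS addr_gt0 ?gram_step_gt0 ?IH.
Qed.

(** Expand [S + e z] and apply the Sherman-Morrison formula to [V + z z^T]. The correction it
    subtracts from [S^T V^-1 S] is a square and is dropped. *)
Lemma normalized_noiseS (E : R) t : (0 < t)%N -> 0 < gram_det t -> `|e t.+1| <= E ->
  normalized_noise t.+1 <= normalized_noise t + 2 * (e t.+1 * noise_gain t)
    + E ^+ 2 * (ln (gram_det t.+1) - ln (gram_det t)).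
Proof.
move=> t0 D0 eE.
have k0 := gram_step_gt0 _ t0 D0; set k := (X in 0 < X) in k0.
have DS : gram_det t.+1 = gram_det t + k by exact: gram_detS.
have D'0 : 0 < gram_det t.+1 by rewrite DS addr_gt0.
have nD : gram_det t != 0 by rewrite gt_eqF.
have nD' : gram_det t + k != 0 by rewrite -DS gt_eqF.
have DE : gram_det t = t%:R * sxx t - sx t ^+ 2 by [].
pose q := x t.+1 * se t - sxe t.
have step : normalized_noise t.+1 = normalized_noise t + 2 * (e t.+1 * noise_gain t)
    + e t.+1 ^+ 2 * (k / gram_det t.+1)
    - (noise_gain t * gram_det t.+1) ^+ 2 / (gram_det t * gram_det t.+1).
  rewrite /normalized_noise /noise_gain DS !sum_uptoS -/sx -/sxx -/se -/sxe
    -/(sx t) -/(sxx t) -/(se t) -/(sxe t) -natr1.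
  have : gram_det t = t%:R * sxx t - sx t ^+ 2 by [].
  move: (gram_det t) nD nD' => D nD nD' DD; rewrite /k in nD' *.
  move: nD nD'; rewrite {}DD => nD nD'.
  by field; apply/andP; split.
(* [z^T V_(t+1)^-1 z] equals [1 - D_t / D_(t+1)], at most minus the logarithm of that ratio; these
   bounds telescope. *)
have kln : k / gram_det t.+1 <= ln (gram_det t.+1) - ln (gram_det t).
  have := @le_ln1Dx R (- (k / gram_det t.+1)).
  have k1 : 1 - k / gram_det t.+1 = gram_det t / gram_det t.+1.
    by rewrite DS; field.
  rewrite k1 ln_div ?posrE// => /(_ _); rewrite ltrNl opprK ltr_pdivrMr// mul1r DS ltrDr.
  by move=> /(_ D0); lra.
rewrite step; apply: (@le_trans _ _ (normalized_noise t + 2 * (e t.+1 * noise_gain t)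
    + e t.+1 ^+ 2 * (k / gram_det t.+1))).
  by rewrite gerBl divr_ge0 ?sqr_ge0// mulr_ge0// ltW.
rewrite lerD2l; apply: ler_pM => //; first exact: sqr_ge0.
  by rewrite divr_ge0// ltW.
rewrite -real_normK ?num_real// ler_sqr// nnegrE//.
exact: le_trans (normr_ge0 _) eE.
Qed.

Lemma gram_det2 : gram_det 2 = (x 1%N - x 2) ^+ 2.
Proof. by rewrite /gram_det !sum_uptoS !sum_upto0; ring. Qed.

(** Two observations at distinct prices are fitted exactly, so projecting the noise onto the
    regressors leaves it unchanged. The recursion starts here. *)
Lemma normalized_noise2 : 0 < gram_det 2 ->
  normalized_noise 2 = e 1%N ^+ 2 + e 2 ^+ 2.
Proof.
rewrite gram_det2 => D2.
have n0 : x 1%N - x 2 != 0 by apply: contraTneq D2 => ->; rewrite expr0n ltxx.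
by rewrite /normalized_noise gram_det2 !sum_uptoS !sum_upto0; field.
Qed.

Lemma normalized_noise_le (E : R) t : (forall tau, `|e tau| <= E) ->
  0 < gram_det 2 -> (2 <= t)%N ->
  normalized_noise t <= 2 * E ^+ 2 + E ^+ 2 * (ln (gram_det t) - ln (gram_det 2))
    + \sum_(2 <= tau < t) 2 * (e tau.+1 * noise_gain tau).
Proof.
move=> eE D2; elim: t => // t IH; rewrite leq_eqVlt => /predU1P[<-|t2].
  rewrite normalized_noise2// big_geq// subrr mulr0 !addr0 mulrC mulr_natr mulr2n.
  by apply: lerD; rewrite -real_normK ?num_real// ler_sqr// nnegrE (le_trans _ (eE 1%N)).
have t0 : (0 < t)%N by lia.
rewrite big_nat_recr//=.
have := normalized_noiseS _ _ t0 (gram_det_gt0 _ D2 t2) (eE t.+1).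
have := IH t2; lra.
Qed.

Lemma gram_det_ge2 t : 0 < gram_det 2 -> (2 <= t)%N -> gram_det 2 <= gram_det t.
Proof.
move=> D2; elim: t => // t IH; rewrite leq_eqVlt => /predU1P[<-//|t2].
apply: (le_trans (IH t2)); rewrite [leRHS]gram_detS lerDl ltW//.
by apply: gram_step_gt0; [lia|exact: gram_det_gt0].
Qed.

(** Whatever the centre [m], the two members of a pair cannot both be close to it: this is the
    parallelogram identity. *)
Lemma pair_sum_sqr (m r : R) (n : nat) : 0 <= r ->
  (forall k, (k < n)%N -> r <= `|x (2 * k).+1 - x (2 * k).+2|) ->
  n%:R * r ^+ 2 / 2 <= sum_upto (fun tau => (x tau - m) ^+ 2) (2 * n).
Proof.
move=> r0; elim: n => [|n IH] xr; first by rewrite muln0 sum_upto0 !mul0r.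
rewrite mulnS add2n !sum_uptoS -natr1 mulrDl mul1r mulrDl -addrA lerD//.
  by apply: IH => k kn; apply: xr; rewrite ltnW.
set a := x _ ; set b := x _.
have : r ^+ 2 <= (a - b) ^+ 2.
  by rewrite -(real_normK (num_real (a - b))) ler_sqr ?nnegrE// /a /b xr.
have := sqr_ge0 (a + b - 2 * m).
rewrite !expr2; lra.
Qed.

(** The determinant is the number of observations times the spread of [x] about its mean; the spread
    is bounded pair by pair. *)
Lemma gram_det_ge (r : R) (n : nat) : 0 <= r ->
  (forall k, (k < n)%N -> r <= `|x (2 * k).+1 - x (2 * k).+2|) ->
  n%:R ^+ 2 * r ^+ 2 <= gram_det (2 * n).
Proof.
move=> r0 xr; case: n xr => [|n] xr.
  by rewrite muln0 /gram_det !sum_upto0 expr0n !mul0r subrr.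
set t := (2 * n.+1)%N.
have t0 : t%:R != 0 :> R by rewrite pnatr_eq0.
have centre (m : R) : sum_upto (fun tau => (x tau - m) ^+ 2) t =
    sxx t - 2 * m * sx t + t%:R * m ^+ 2.
  rewrite /sxx /sx; elim: (t) => [|s IH]; first by rewrite !sum_upto0; ring.
  by rewrite !sum_uptoS IH -natr1; ring.
have -> : gram_det t = t%:R * sum_upto (fun tau => (x tau - sx t / t%:R) ^+ 2) t.
  by rewrite centre /gram_det -/sx -/sxx -/(sx t) -/(sxx t); field.
have := pair_sum_sqr (sx t / t%:R) r n.+1 r0 xr; rewrite -/t => h.
apply: le_trans (ler_wpM2l (ler0n _ _) h).
by rewrite /t natrM; lra.
Qed.

Lemma gram_det_le (X : R) t : (forall tau, (0 < tau)%N -> `|x tau| <= X) -> gram_det t <= (t%:R * X) ^+ 2.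
Proof.
move=> xX; rewrite /gram_det lerBlDr ler_wpDr ?sqr_ge0//.
rewrite exprMn expr2 -mulrA ler_wpM2l// /sum_upto.
apply: (@le_trans _ _ (\sum_(1 <= tau < t.+1) X ^+ 2)).
  apply: ler_sum_nat => tau /andP[tau0 _].
  rewrite -real_normK ?num_real// ler_sqr ?xX// nnegrE.
  exact: le_trans (xX tau tau0).
by rewrite big_const_nat iter_addr_0 subn1 /= mulr_natl.
Qed.

Lemma least_squares_normal t (y : nat -> R) a b : is_LS t x y a b ->
  sum_upto (fun tau => y tau - (a - b * x tau)) t = 0 /\
  sum_upto (fun tau => (y tau - (a - b * x tau)) * x tau) t = 0.
Proof.
move=> LS; pose r tau := y tau - (a - b * x tau).
have pert (z : nat -> R) : (forall s, exists a' b', forall tau,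
      y tau - (a' - b' * x tau) = r tau + s * z tau) ->
    sum_upto (fun tau => r tau * z tau) t = 0.
  move=> pz; set c := sum_upto _ _; set q := sum_upto (fun tau => z tau ^+ 2) t.
  have q0 : 0 <= q by apply: sumr_ge0 => tau _; exact: sqr_ge0.
  have q1 : q + 1 != 0 by rewrite gt_eqF// ltr_wpDl.
  (* Nearly the best step along [z]; the denominator [q + 1] instead of [q] covers [z = 0]. *)
  have [a' [b' ab']] := pz (- c / (q + 1)).
  have := LS a' b'; rewrite -/(sum_upto (fun tau => (y tau - (a' - b' * x tau)) ^+ 2) t).
  have -> : sum_upto (fun tau => (y tau - (a' - b' * x tau)) ^+ 2) t =
      sum_upto (fun tau => r tau ^+ 2) t + (- c / (q + 1)) * 2 * c + (- c / (q + 1)) ^+ 2 * q.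
    rewrite /c /q; move: (- _ / _) ab' => s ab'; rewrite {q0 q1}.
    elim: (t) => [|u IH]; first by rewrite !sum_upto0; ring.
    by rewrite !sum_uptoS IH ab'; ring.
  rewrite -/(sum_upto (fun tau => (y tau - (a - b * x tau)) ^+ 2) t) -/(sum_upto (fun tau => r tau ^+ 2) t).
  rewrite -addrA lerDl.
  have -> : - c / (q + 1) * 2 * c + (- c / (q + 1)) ^+ 2 * q = - (c / (q + 1)) ^+ 2 * (q + 2).
    by field.
  rewrite mulNr oppr_ge0 pmulr_lle0; last by rewrite ltr_wpDl.
  move=> c0; have /eqP : (c / (q + 1)) ^+ 2 = 0.
    by apply/eqP; rewrite eq_le c0 sqr_ge0.
  by rewrite sqrf_eq0 mulf_eq0 invr_eq0 (negbTE q1) orbF => /eqP.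
split.
  have := pert (fun=> 1); under eq_fun do rewrite mulr1; apply.
  by move=> s; exists (a - s), b => tau; rewrite /r; ring.
apply: (pert x) => s; exists a, (b + s) => tau; rewrite /r; ring.
Qed.

Lemma least_squares_error t (alpha beta a b : R) : 0 < gram_det t ->
  is_LS t x (fun tau => alpha - beta * x tau + e tau) a b ->
  a = alpha + (sxx t * se t - sx t * sxe t) / gram_det t /\
  b = beta + (sx t * se t - t%:R * sxe t) / gram_det t.
Proof.
move=> D0 /least_squares_normal[n1 n2].
have D0' : t%:R * sxx t - sx t ^+ 2 != 0 by rewrite gt_eqF.
have e1 : se t - (a - alpha) * t%:R + (b - beta) * sx t = 0.
  rewrite -[RHS]n1 /se /sx; elim: (t) => [|s IH]; first by rewrite !sum_upto0; ring.
  by rewrite !sum_uptoS -IH -natr1; ring.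
have e2 : sxe t - (a - alpha) * sx t + (b - beta) * sxx t = 0.
  rewrite -[RHS]n2 /sxe /sxx /sx; elim: (t) => [|s IH]; first by rewrite !sum_upto0; ring.
  by rewrite !sum_uptoS -IH; ring.
rewrite /gram_det -/(sx t) -/(sxx t).
have -> : se t = (a - alpha) * t%:R - (b - beta) * sx t by move: e1; lra.
have -> : sxe t = (a - alpha) * sx t - (b - beta) * sxx t by move: e2; lra.
by split; field.
Qed.

Lemma normalized_noise_ge0 t : (0 < t)%N -> 0 < gram_det t -> 0 <= normalized_noise t.
Proof.
move=> t0 D0; have t0' : 0 < t%:R :> R by rewrite ltr0n.
rewrite /normalized_noise divr_ge0 ?(ltW D0)//= -(pmulr_rge0 _ t0').
rewrite [X in 0 <= X](_ : _ = (t%:R * sxe t - sx t * se t) ^+ 2 + gram_det t * se t ^+ 2).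
  by rewrite addr_ge0 ?sqr_ge0// mulr_ge0 ?sqr_ge0// ltW.
by rewrite /gram_det -/(sx t) -/(sxx t) -/(se t) -/(sxe t); ring.
Qed.

(** The normalised noise is the quadratic form of [V] at the parameter error, and the least
    eigenvalue of [V] is at least determinant over trace; the trace is at most [t (1 + X^2)]. *)
Lemma least_squares_error_le t (alpha beta a b X : R) : (0 < t)%N -> 0 < gram_det t ->
  (forall tau, (0 < tau)%N -> `|x tau| <= X) ->
  is_LS t x (fun tau => alpha - beta * x tau + e tau) a b ->
  (a - alpha) ^+ 2 + (b - beta) ^+ 2 <=
    t%:R * (1 + X ^+ 2) * normalized_noise t / gram_det t.
Proof.
move=> t0 D0 xX /(least_squares_error _ _ _ _ _ D0)[-> ->].
have t0' : 0 < t%:R :> R by rewrite ltr0n.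
have sX : sxx t <= t%:R * X ^+ 2.
  rewrite /sxx /sum_upto.
  apply: (@le_trans _ _ (\sum_(1 <= tau < t.+1) X ^+ 2)).
    apply: ler_sum_nat => tau /andP[tau0 _].
    rewrite -real_normK ?num_real// ler_sqr ?xX// nnegrE.
    exact: le_trans (xX tau tau0).
  by rewrite big_const_nat iter_addr_0 subn1 /= mulr_natl.
have D0' : t%:R * sxx t - sx t ^+ 2 != 0 by rewrite gt_eqF.
rewrite ![_ + _ / _ - _]addrC !addKr.
set u := _ / _; set v := _ / _.
have se_E : se t = u * t%:R - v * sx t.
  by rewrite /u /v /gram_det -/(sx t) -/(sxx t); field.
have sxe_E : sxe t = u * sx t - v * sxx t.
  by rewrite /u /v /gram_det -/(sx t) -/(sxx t); field.
have ME : normalized_noise t = t%:R * u ^+ 2 - 2 * sx t * u * v + sxx t * v ^+ 2.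
  rewrite /normalized_noise -/(sx t) -/(sxx t) -/(se t) -/(sxe t) se_E sxe_E.
  by rewrite /gram_det -/(sx t) -/(sxx t); field.
have DE : gram_det t = t%:R * sxx t - sx t ^+ 2 by [].
have v2 : gram_det t * v ^+ 2 <= t%:R * normalized_noise t.
  rewrite ME -subr_ge0 DE [X in 0 <= X](_ : _ = (t%:R * u - sx t * v) ^+ 2) ?sqr_ge0//; ring.
have u2 : gram_det t * u ^+ 2 <= sxx t * normalized_noise t.
  rewrite ME -subr_ge0 DE [X in 0 <= X](_ : _ = (sxx t * v - sx t * u) ^+ 2) ?sqr_ge0//; ring.
have M0 := normalized_noise_ge0 t t0 D0.
rewrite ler_pdivlMr// mulrC mulrDr.
have := ler_wpM2r M0 sX; lra.
Qed.

End LeastSquares.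

(** * Elementary estimates *)

Section PowerSums.
Variable R : realType.

(** Young's inequality for the product of [(1 - u) ^ r] and 1, with exponents [1 / r] and
    [1 / (1 - r)]. *)
Lemma bernoulli_powR (u r : R) : 0 <= u <= 1 -> 0 < r < 1 -> (1 - u) `^ r <= 1 - r * u.
Proof.
move=> /andP[u0 u1] /andP[r0 r1].
have r1' : 0 < 1 - r by rewrite subr_gt0.
have := @conjugate_powR R ((1 - u) `^ r) 1 r^-1 (1 - r)^-1 (powR_ge0 _ _) ler01.
rewrite !invr_gt0 !invrK => /(_ r0 r1').
rewrite -powRrM mulfV ?gt_eqF// powRr1 ?subr_ge0// powR1 mulr1 addrC subrK => /(_ erefl).
lra.
Qed.

(** A discrete comparison with the integral; the induction step is Bernoulli's inequality with
    [u = 1 / (D + 1)]. *)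
Lemma powR_sum_le (s : R) (D : nat) : 0 < s < 1 ->
  \sum_(1 <= d < D.+1) d%:R `^ (- s) <= (D%:R `^ (1 - s)) / (1 - s) :> R.
Proof.
move=> /andP[s0 s1].
have s1' : 0 < 1 - s by rewrite subr_gt0.
elim: D => [|D IH]; first by rewrite big_geq// divr_ge0 ?powR_ge0// ltW.
rewrite big_nat_recr//=; apply: (le_trans (lerD IH (lexx _))).
rewrite ler_pdivlMr// mulrDl divfK ?gt_eqF//.
have D0 : 0 < D.+1%:R :> R by rewrite ltr0n.
have Dn : D.+1%:R != 0 :> R by rewrite gt_eqF.
have u01 : 0 <= (D.+1%:R^-1 : R) <= 1.
  by rewrite invr_ge0 ltW//= invf_le1// ler1n.
have r01 : 0 < 1 - s < 1 by rewrite s1' ltrBlDr ltrDl.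
have -> : D%:R = D.+1%:R * (1 - D.+1%:R^-1) :> R.
  by rewrite mulrBr mulr1 mulfV// -natr1 addrK.
rewrite powRM ?subr_ge0 ?(ltW D0)//; last by case/andP: u01.
have -> : D.+1%:R `^ (- s) = D.+1%:R `^ (1 - s) * D.+1%:R^-1 :> R.
  rewrite -(powR_inv1 (ltW D0)) -powRD; last by rewrite Dn implybT.
  by congr (_ `^ _); ring.
rewrite -lerBrDr.
apply: (le_trans (ler_wpM2l (powR_ge0 _ _) (bernoulli_powR _ _ u01 r01))).
by rewrite mulrBr mulr1 lerD2l lerN2 -mulrA [_^-1 * _]mulrC.
Qed.

(** From day 3 on, the estimate in use rests on at least half as many days as the current date;
    changing the base costs at most [2 ^ k <= 2]. *)
Lemma powR_double (t d : nat) (k : R) : 0 <= k <= 1 -> (0 < t)%N -> (0 < d)%N -> (d <= 2 * t)%N ->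
  t%:R `^ (- k) <= 2 * d%:R `^ (- k) :> R.
Proof.
move=> /andP[k0 k1] t0 d0 dt.
have t0' : 0 < t%:R :> R by rewrite ltr0n.
have d0' : 0 < d%:R :> R by rewrite ltr0n.
rewrite !powRN ler_pdivlMr ?powR_gt0// mulrC ler_pdivrMr ?powR_gt0//.
apply: (@le_trans _ _ ((2 * t%:R) `^ k)).
  apply: ge0_ler_powR => //; rewrite ?nnegrE ?mulr_ge0//.
  by rewrite -natrM ler_nat.
by rewrite powRM// ler_wpM2r ?powR_ge0// ler1_powR// ler1n.
Qed.

Lemma le1_powRN (d : nat) (k : R) : (0 < d)%N -> 0 <= k -> d%:R `^ (- k) <= 1 :> R.
Proof.
move=> d0 k0; rewrite powRN invf_le1 ?powR_gt0 ?ltr0n//.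
apply: (@le_trans _ _ (d%:R `^ 0)); first by rewrite powRr0.
by apply: ler_powR => //; rewrite ler1n.
Qed.

End PowerSums.

Section ScalarBounds.
Variable R : realType.

Lemma clip_dist (lo hi y z : R) : lo <= y <= hi -> `|clip lo hi z - y| <= `|z - y|.
Proof.
move=> /andP[loy yhi]; rewrite /clip.
case: (lerP z lo) => zlo; first by rewrite min_l ?(le_trans loy)//; case: ler0P => ?; case: ler0P => ?; lra.
by case: (lerP z hi) => zhi //; case: ler0P => ?; case: ler0P => ?; lra.
Qed.

Lemma clip_box (lo hi z : R) : lo <= hi -> lo <= clip lo hi z <= hi.
Proof.
move=> lohi; rewrite /clip le_min lohi ge_min lexx orbT !andbT.
by rewrite le_max lexx orbT.
Qed.

Lemma min_dist (a b u v : R) : `|Num.min a b - Num.min u v| <= `|a - u| + `|b - v|.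
Proof.
have := ler_norm (a - u); have := ler_norm (b - v).
have := ler_norm (u - a); have := ler_norm (v - b).
rewrite (distrC u) (distrC v) ler_norml => h1 h2 h3 h4.
by case: (lerP a b) => ab; case: (lerP u v) => uv; apply/andP; split; lra.
Qed.

(** The weight is kept as a product: [q] will be the learning rate and [s] the logarithmic
    factor. *)
Lemma young_norm (u v s q : R) : 0 < s -> 0 < q ->
  `|u| + `|v| <= s * q + (u ^+ 2 + v ^+ 2) / (2 * (s * q)).
Proof.
move=> s0 q0; set z := s * q; have z0 : 0 < z by exact: mulr_gt0.
rewrite -(real_normK (num_real u)) -(real_normK (num_real v)).
move: `|u| `|v| => {}u {}v; rewrite -subr_ge0.
rewrite [X in 0 <= X](_ : _ = ((u - z) ^+ 2 + (v - z) ^+ 2) / (2 * z)).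
  by rewrite divr_ge0 ?addr_ge0 ?sqr_ge0// mulr_ge0// ltW.
by field; rewrite gt_eqF.
Qed.

Lemma sum_upto_le (f : nat -> R) (C : R) t : (forall tau, (0 < tau)%N -> `|f tau| <= C) ->
  `|sum_upto R f t| <= t%:R * C.
Proof.
move=> fC; elim: t => [|t IH]; first by rewrite sum_upto0 normr0 mul0r.
by rewrite sum_uptoS (le_trans (ler_normD _ _))// -natr1 mulrDl mul1r lerD// fC.
Qed.

Lemma cvg_sum_upto (T : Type) (F : set_system T) (FF : Filter F)
    (f : T -> nat -> R) (l : nat -> R) (t : nat) :
  (forall tau, (0 < tau <= t)%N -> f v tau @[v --> F] --> l tau) ->
  sum_upto R (f v) t @[v --> F] --> sum_upto R l t.
Proof.
elim: t => [|t IH] fl.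
  by under eq_fun do rewrite sum_upto0; rewrite sum_upto0; exact: cvg_cst.
under eq_fun do rewrite sum_uptoS; rewrite sum_uptoS; apply: cvgD.
  by apply: IH => tau /andP[t0 tt]; apply: fl; rewrite t0 ltnW.
by apply: fl; rewrite /= leqnn.
Qed.

Lemma cvg_gram_det (T : Type) (F : set_system T) (FF : Filter F)
    (x : T -> nat -> R) (l : nat -> R) (t : nat) :
  (forall tau, (0 < tau <= t)%N -> x v tau @[v --> F] --> l tau) ->
  gram_det R (x v) t @[v --> F] --> gram_det R l t.
Proof.
move=> xl; rewrite /gram_det; apply: cvgB.
  apply: cvgM; first exact: cvg_cst.
  by apply: cvg_sum_upto => tau tt; rewrite expr2; apply: cvgM; exact: xl.
by rewrite expr2; apply: cvgM; apply: cvg_sum_upto.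
Qed.

Lemma cvg_noise_gain (T : Type) (F : set_system T) (FF : Filter F)
    (x e : T -> nat -> R) (lx le : nat -> R) (t : nat) :
  (forall tau, (0 < tau <= t.+1)%N -> x v tau @[v --> F] --> lx tau) ->
  (forall tau, (0 < tau <= t)%N -> e v tau @[v --> F] --> le tau) ->
  gram_det R lx t.+1 != 0 ->
  noise_gain R (x v) (e v) t @[v --> F] --> noise_gain R lx le t.
Proof.
move=> xl el D0; rewrite /noise_gain.
have xl' tau : (0 < tau <= t)%N -> x v tau @[v --> F] --> lx tau.
  by move=> /andP[t0 tt]; apply: xl; rewrite t0 ltnW.
have csx := cvg_sum_upto _ _ FF x lx t xl'.
have cse := cvg_sum_upto _ _ FF e le t el.
have csxx : sum_upto R (fun tau => x v tau ^+ 2) t @[v --> F] -->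
    sum_upto R (fun tau => lx tau ^+ 2) t.
  by apply: cvg_sum_upto => tau tt; rewrite expr2; apply: cvgM; exact: xl'.
have csxe : sum_upto R (fun tau => x v tau * e v tau) t @[v --> F] -->
    sum_upto R (fun tau => lx tau * le tau) t.
  by apply: cvg_sum_upto => tau tt; apply: cvgM; [exact: xl'|exact: el].
have cx : x v t.+1 @[v --> F] --> lx t.+1 by apply: xl; rewrite /= leqnn.
have cD := cvg_gram_det _ _ FF x lx t.+1 xl.
cbv zeta; apply: cvgM; last by apply: cvgV.
apply: cvgD.
  apply: cvgB; first apply: cvgB.
  - exact: cvgM.
  - by apply: cvgM => //; exact: cvgM.
  - exact: cvgM.
by apply: cvgM => //; apply: cvgM => //; exact: cvg_cst.
Qed.

End ScalarBounds.

(** * Limits along a filter *)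

Section FilterLimits.
Context (R : realType) (T : Type) (F : set_system T) {FF : Filter F}.

Lemma cvg_dominated (f g : T -> R) (l : R) :
  (forall v, `|f v - l| <= g v) -> g @ F --> (0 : R) -> f @ F --> l.
Proof.
move=> fg g0; apply/cvgrPdist_lt => e e0.
move/cvgrPdist_lt : g0 => /(_ e e0); apply: filterS => v.
rewrite sub0r normrN distrC => ge; apply: (le_lt_trans (fg v)).
exact: le_lt_trans (ler_norm _) ge.
Qed.

Lemma cvg_bigsum (I : Type) (s : seq I) (p : pred I) (f : T -> I -> R) (l : I -> R) :
  (forall i, p i -> f v i @[v --> F] --> l i) ->
  \sum_(i <- s | p i) f v i @[v --> F] --> \sum_(i <- s | p i) l i.
Proof.
move=> fl; elim: s => [|i s IH].
  by under eq_fun do rewrite big_nil; rewrite big_nil; exact: cvg_cst.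
case pi : (p i); under eq_fun do rewrite big_cons pi; rewrite big_cons pi; last exact: IH.
by apply: cvgD => //; exact: fl.
Qed.

Lemma cvg_link_sum (N : nat) (f : T -> lnk R N) (l : lnk R N) :
  (forall i j : 'I_N, i != j -> f v i j @[v --> F] --> l i j) ->
  link_sum R N (f v) @[v --> F] --> link_sum R N l.
Proof.
move=> fl; apply: cvg_bigsum => i _; apply: cvg_bigsum => j; rewrite eq_sym; exact: fl.
Qed.

Lemma cvg_dist0 (f : T -> R) (l : R) : f @ F --> l -> `|f v - l| @[v --> F] --> (0 : R).
Proof.
move=> fl; rewrite -(normr0 R) -(subrr l).
by apply: cvg_norm; apply: cvgB => //; exact: cvg_cst.
Qed.

Lemma clip_lipschitz (lo hi y z : R) : `|clip lo hi z - clip lo hi y| <= `|z - y|.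
Proof.
rewrite /clip; have := min_dist R (Num.max z lo) hi (Num.max y lo) hi.
rewrite subrr normr0 addr0 => /le_trans; apply.
have := min_dist R (- z) (- lo) (- y) (- lo).
by rewrite !subrr normr0 addr0 -!oppr_max -!opprD !normrN.
Qed.

Lemma cvg_clip (lo hi : R) (f : T -> R) (l : R) : f @ F --> l ->
  clip lo hi (f v) @[v --> F] --> clip lo hi l.
Proof.
move=> fl; apply: cvg_dominated (cvg_dist0 _ _ fl) => v; exact: clip_lipschitz.
Qed.
End FilterLimits.

(** Days come in pairs [2k+1], [2k+2] that share the estimate of time [2k]; here [k] is
    [d.-1./2]. *)
Lemma odd_even_day d : (0 < d)%N -> d = (2 * d.-1./2).+1 \/ d = (2 * d.-1./2).+2.
Proof. by have := odd_double_half d.-1; lia. Qed.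

(** * A run of the policy *)

Section Run.
Context (R : realType) (N : nat)
  (alpha beta xi : lnk R N) (amin amax bmin bmax pmax c elo ehi : R)
  (dsp : measure_display) (Omega : measurableType dsp) (P : probability Omega R)
  (eps : nat -> Omega -> lnk R N) (a0 b0 : Omega -> lnk R N)
  (pstar : lnk R N -> lnk R N -> lnk R N).
Hypothesis amin_amax : amin <= amax.
Hypothesis bmin_gt0 : 0 < bmin.
Hypothesis bmin_bmax : bmin <= bmax.
Hypothesis box : in_box amin amax bmin bmax alpha beta.
Hypothesis xi_gt0 : forall i j : 'I_N, i != j -> 0 < xi i j.
Hypothesis c_gt0 : 0 < c.
Hypothesis eps_rng : forall (dd : nat) (w : Omega) (i j : 'I_N), i != j ->
  elo <= eps dd w i j <= ehi.
Hypothesis eps_meas : forall (dd : nat) (i j : 'I_N),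
  measurable_fun setT (fun w => eps dd w i j).
Hypothesis eps_mean : forall i j : 'I_N, i != j -> (\int[P]_w (eps 1%N w i j)%:E = 0)%E.
Hypothesis indep : shocks_iid_indep P eps a0 b0.
Hypothesis a0_meas : forall i j : 'I_N, measurable_fun setT (fun w => a0 w i j).
Hypothesis b0_meas : forall i j : 'I_N, measurable_fun setT (fun w => b0 w i j).
Hypothesis box0 : forall w : Omega, in_box amin amax bmin bmax (a0 w) (b0 w).
Hypothesis pstar_opt : forall a b : lnk R N, in_box amin amax bmin bmax a b ->
  is_opt xi (epsminus P eps) c pmax a b (pstar a b).

Variable K : R.
Hypothesis K_gt0 : 0 < K.
Hypothesis K_lip : forall a' b' p' : lnk R N,
  in_box amin amax bmin bmax a' b' -> kkt R N xi (epsminus P eps) c a' b' p' ->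
  forall i j : 'I_N, i != j -> `|p' i j - pstar alpha beta i j| <=
    K * link_sum R N (fun i j => `|a' i j - alpha i j| + `|b' i j - beta i j|).

Variables (rho eta : R) (price supply ahat bhat atil btil : nat -> Omega -> lnk R N).
Hypothesis rho_gt0 : 0 < rho.
Hypothesis eta_rng : 0 < eta < 2^-1.
Hypothesis run : nrps_run eps a0 b0 alpha beta amin amax bmin bmax pstar rho eta
  price supply ahat bhat atil btil.
Hypothesis zcap : forall (w : Omega) (dd : nat), (0 < dd)%N ->
  zero_cap_dual xi (epsminus P eps) c pmax (ahat dd.-1 w) (bhat dd.-1 w).

(** * Bounded prices and their dispersion *)

Definition est_diam : R := link_sum R N (fun _ _ => (amax - amin) + (bmax - bmin)).
(** Feasibility bounds prices only from above. The two-sided bound combines the clairvoyant price,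
    its Lipschitz deviation over the parameter box, and the largest perturbation. *)
Definition price_bound : R :=
  link_sum R N (fun i j => `|pstar alpha beta i j|) + K * est_diam + rho / bmin.
Definition shock_bound : R := `|elo| + `|ehi|.

Definition est_error (t : nat) (w : Omega) : R :=
  link_sum R N (fun i j => `|ahat t w i j - alpha i j| + `|bhat t w i j - beta i j|).

Lemma est_box t w : in_box amin amax bmin bmax (ahat t w) (bhat t w).
Proof.
move=> i j ij; case: t => [|t].
  by have [/(_ i j ij)[-> ->] _] := run w; exact: box0.
have [_ [/(_ t.+1 isT i j ij)[_ [-> ->]] _]] := run w.
by split; exact: clip_box.
Qed.

Lemma est_kkt t w :
  kkt R N xi (epsminus P eps) c (ahat t w) (bhat t w) (pstar (ahat t w) (bhat t w)).
Proof.
apply: (zero_cap_kkt _ _ _ _ _ pmax) => //.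
- by move=> i j /(est_box t w)[_ /andP[+ _]]; exact: lt_le_trans.
- by apply: pstar_opt; exact: est_box.
- exact: (zcap w t.+1).
Qed.

Lemma shock_le dd w i j : i != j -> `|eps dd w i j| <= shock_bound.
Proof.
move=> ij; have /andP[? ?] := eps_rng dd w _ _ ij; rewrite /shock_bound.
have := ler_norm ehi; have := ler_norm (- elo); rewrite normrN ler_norml.
by have := normr_ge0 ehi; have := normr_ge0 elo; lra.
Qed.

Lemma est_error_ge0 t w : 0 <= est_error t w.
Proof. by apply: link_sum_ge0 => i j _; rewrite addr_ge0. Qed.

Lemma est_error_le t w : est_error t w <= est_diam.
Proof.
apply: le_link_sum => i j ij.
have [/andP[? ?] /andP[? ?]] := est_box t w i j ij.
have [/andP[? ?] /andP[? ?]] := box i j ij.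
by apply: lerD; rewrite ler_norml; apply/andP; split; lra.
Qed.

Lemma est_diam_ge0 : 0 <= est_diam.
Proof. by apply: link_sum_ge0 => i j _; rewrite addr_ge0// subr_ge0. Qed.

Lemma pstar_error t w i j : i != j ->
  `|pstar (ahat t w) (bhat t w) i j - pstar alpha beta i j| <= K * est_error t w.
Proof. by move=> ij; apply: K_lip => //; [exact: est_box|exact: est_kkt]. Qed.

Lemma price_odd k w i j : i != j ->
  price (2 * k).+1 w i j = pstar (ahat (2 * k) w) (bhat (2 * k) w) i j.
Proof.
move=> ij; have [_ [_ [/(_ (2 * k).+1) + _]]] := run w.
by move=> /(_ _ i j ij)[|//]; rewrite /= mul2n odd_double.
Qed.

Lemma price_even k w i j : i != j ->
  price (2 * k).+2 w i j = pstar (ahat (2 * k) w) (bhat (2 * k) w) i j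
    - rho / bhat (2 * k) w i j * ((2 * k).+2%:R `^ (- eta)).
Proof.
move=> ij; have [_ [_ [_ /(_ (2 * k).+2 isT)]]] := run w.
rewrite /= mul2n odd_double /= => /(_ isT i j ij)[-> _].
by rewrite subn2.
Qed.

Lemma pstar_le i j : i != j ->
  `|pstar alpha beta i j| <= link_sum R N (fun i j => `|pstar alpha beta i j|).
Proof. by apply: (link_sum_term R N (fun i j => `|pstar alpha beta i j|)). Qed.

Lemma perturb_le t w i j d : i != j -> (0 < d)%N ->
  0 <= rho / bhat t w i j * (d%:R `^ (- eta)) <= rho / bmin * (d%:R `^ (- eta)).
Proof.
move=> ij d0; have [_ /andP[b1 b2]] := est_box t w i j ij.
have bp : 0 < bhat t w i j by exact: lt_le_trans b1.
rewrite mulr_ge0 ?powR_ge0 ?divr_ge0 ?(ltW rho_gt0) ?(ltW bp)//=.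
by rewrite ler_wpM2r ?powR_ge0// ler_wpM2l ?(ltW rho_gt0)// lef_pV2.
Qed.

Lemma price_le d w i j : i != j -> (0 < d)%N -> `|price d w i j| <= price_bound.
Proof.
move=> ij d0.
have et : 0 <= eta by case/andP: eta_rng => /ltW.
have rb : 0 <= rho / bmin by rewrite divr_ge0// ltW.
have base t : `|pstar (ahat t w) (bhat t w) i j| <=
    link_sum R N (fun i j => `|pstar alpha beta i j|) + K * est_diam.
  rewrite -(subrK (pstar alpha beta i j) (pstar _ _ _ _)) addrC.
  apply: (le_trans (ler_normD _ _)); apply: lerD; first exact: pstar_le.
  apply: (le_trans (pstar_error _ _ _ _ ij)).
  by rewrite ler_pM2l// est_error_le.
have dE : d.-1 = (2 * (d.-1)./2 + odd d.-1)%N.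
  by rewrite mul2n addnC odd_double_half.
case od : (odd d.-1) dE => dE.
  have -> : d = (2 * (d.-1)./2).+2 by rewrite -[LHS](prednK d0) {1}dE addn1.
  set k := (d.-1)./2; rewrite price_even// (le_trans (ler_normB _ _))// lerD//.
  have /andP[h1 h2] := perturb_le (2 * k) w i j (2 * k).+2 ij isT.
  rewrite ger0_norm// (le_trans h2)// ler_piMr//.
  exact: le1_powRN.
have -> : d = (2 * (d.-1)./2).+1 by rewrite -[LHS](prednK d0) {1}dE addn0.
by rewrite price_odd// (le_trans (base _))// lerDl.
Qed.

(** The least price gap within the first [n] pairs: the latest day [2 * n] and the largest slope
    [bmax]. *)
Definition explore (n : nat) : R := rho / bmax * ((2 * n)%:R `^ (- eta)).

Lemma explore_gt0 n : (0 < n)%N -> 0 < explore n.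
Proof.
move=> n0; have bM : 0 < bmax by exact: lt_le_trans bmin_bmax.
by rewrite mulr_gt0 ?divr_gt0 ?powR_gt0// ltr0n muln_gt0.
Qed.

Lemma price_gap n k w i j : i != j -> (k < n)%N ->
  explore n <= `|price (2 * k).+1 w i j - price (2 * k).+2 w i j|.
Proof.
move=> ij kn; rewrite price_odd// price_even// opprB addrCA subrr addr0.
have /andP[h1 h2] := perturb_le (2 * k) w i j (2 * k).+2 ij isT.
rewrite ger0_norm//.
have [_ /andP[b1 b2]] := est_box (2 * k) w i j ij.
have bp : 0 < bhat (2 * k) w i j by exact: lt_le_trans b1.
apply: ler_pM; rewrite ?powR_ge0//.
- by rewrite divr_ge0 ?(ltW rho_gt0)// ltW// (lt_le_trans bp).
- by rewrite ler_wpM2l ?(ltW rho_gt0)// lef_pV2 ?posrE// (lt_le_trans bp).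
rewrite !powRN lef_pV2 ?posrE ?powR_gt0 ?ltr0n//; last by move: kn; clear; lia.
apply: ge0_ler_powR; rewrite ?nnegrE//; first by case/andP: eta_rng => /ltW.
by rewrite ler_nat; move: kn; clear; lia.
Qed.

Lemma price_det_ge n w i j : i != j ->
  n%:R ^+ 2 * explore n ^+ 2 <= gram_det R (fun d => price d w i j) (2 * n).
Proof.
move=> ij; apply: gram_det_ge => [|k kn]; last exact: price_gap.
case: n => [|n]; last exact/ltW/explore_gt0.
rewrite /explore mulr_ge0 ?powR_ge0// divr_ge0 ?(ltW rho_gt0)//.
by rewrite ltW// (lt_le_trans bmin_gt0).
Qed.

Lemma price_det2_gt0 w i j : i != j -> 0 < gram_det R (fun d => price d w i j) 2.
Proof.
move=> ij; apply: lt_le_trans (price_det_ge 1 w i j ij).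
by rewrite expr1n mul1r exprn_gt0// explore_gt0.
Qed.

Lemma price_det_gt0 w i j t : i != j -> (2 <= t)%N ->
  0 < gram_det R (fun d => price d w i j) t.
Proof. by move=> ij t2; apply: gram_det_gt0 => //; exact: price_det2_gt0. Qed.

(** * Continuity of the run in the history *)

Local Notation H := (hist_nbhs dsp Omega R N eps a0 b0).

Definition hist_continuous (m : nat) (f : Omega -> R) : Prop :=
  forall w, f @ H m w --> f w.

Lemma hist_continuousW m m' f : (m <= m')%N -> hist_continuous m f -> hist_continuous m' f.
Proof.
move=> mm' cf w A /(cf w)[e /= e0 He]; exists e => //= v /= vX; apply: He => -[[k i] j].
by have := vX (widen_ord (_ : (m.+2 <= m'.+2)%N) k, i, j); apply.
Qed.

Lemma shock_continuous m tau i j : i != j -> (0 < tau <= m)%N ->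
  hist_continuous m (fun w => eps tau w i j).
Proof.
move=> ij; case: tau => // t /= tm w.
have tm' : (t.+2 < m.+2)%N by [].
have := nearby_coord _ _ _ (hist_coord _ Omega R N eps a0 b0 m) w (Ordinal tm', i, j).
by rewrite /hist_coord /= (negbTE ij).
Qed.

Lemma est0_continuous i j : i != j -> hist_continuous 0 (fun w => ahat 0 w i j) /\
  hist_continuous 0 (fun w => bhat 0 w i j).
Proof.
move=> ij.
have -> : (fun w => ahat 0 w i j) = (fun w => a0 w i j).
  by apply/funext => w; have [/(_ i j ij)[]] := run w.
have -> : (fun w => bhat 0 w i j) = (fun w => b0 w i j).
  by apply/funext => w; have [/(_ i j ij)[]] := run w.
split=> w.
  have := nearby_coord _ _ _ (hist_coord _ Omega R N eps a0 b0 0) w (ord0, i, j).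
  by rewrite /hist_coord /= (negbTE ij).
have := nearby_coord _ _ _ (hist_coord _ Omega R N eps a0 b0 0) w (ord_max, i, j).
by rewrite /hist_coord /= (negbTE ij).
Qed.

(** The Lipschitz estimate is taken with the estimates at [w] as base point. Its constant varies
    with [w], which is enough for continuity at [w]. *)
Lemma pstar_continuous m t :
  (forall i j : 'I_N, i != j -> hist_continuous m (fun w => ahat t w i j) /\
    hist_continuous m (fun w => bhat t w i j)) ->
  forall i j : 'I_N, i != j ->
    hist_continuous m (fun w => pstar (ahat t w) (bhat t w) i j).
Proof.
move=> ct i j ij w.
have [L L0 Llip] := kkt_lipschitz _ _ _ _ _ _ _ _ _ _ _ _ xi_gt0 bmin_gt0 (est_box t w) (est_kkt t w).
pose D v := link_sum R N (fun i j => `|ahat t v i j - ahat t w i j|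
  + `|bhat t v i j - bhat t w i j|).
apply: (@cvg_dominated _ _ _ _ _ (fun v => L * D v)).
  by move=> v; apply: Llip => //; [exact: est_box|exact: est_kkt].
rewrite -(mulr0 L); apply: cvgM; first exact: cvg_cst.
have -> : (0 : R) = link_sum R N (fun _ _ => 0 + 0).
  by rewrite /link_sum big1// => k _; rewrite big1// => l _; rewrite addr0.
apply: cvg_link_sum => k l kl; have [ca cb] := ct k l kl.
by apply: cvgD; apply: cvg_dist0; [exact: ca|exact: cb].
Qed.

Lemma price_continuous_step n :
  (forall i j : 'I_N, i != j -> hist_continuous (2 * n) (fun w => ahat (2 * n) w i j) /\
    hist_continuous (2 * n) (fun w => bhat (2 * n) w i j)) ->
  forall i j : 'I_N, i != j ->
    hist_continuous (2 * n) (fun w => price (2 * n).+1 w i j) /\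
    hist_continuous (2 * n) (fun w => price (2 * n).+2 w i j).
Proof.
move=> ct i j ij; have cp := pstar_continuous _ _ ct i j ij.
split => w.
  by rewrite price_odd//; under eq_fun do rewrite price_odd//; exact: cp.
rewrite price_even//; under eq_fun do rewrite price_even//.
apply: cvgB; first exact: cp.
apply: cvgM; last exact: cvg_cst.
apply: cvgM; first exact: cvg_cst.
apply: cvgV; last by have [_] := ct i j ij; apply.
have [_ /andP[b1 _]] := est_box (2 * n) w i j ij.
by rewrite gt_eqF// (lt_le_trans _ b1).
Qed.

(** A positive Gram determinant makes the minimiser a rational function of past prices and shocks,
    and clipping is continuous. *)
Lemma est_continuous_step n : (0 < n)%N ->
  (forall tau, (0 < tau <= 2 * n)%N -> forall i j : 'I_N, i != j ->
    hist_continuous (2 * n) (fun w => price tau w i j)) ->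
  forall i j : 'I_N, i != j -> hist_continuous (2 * n) (fun w => ahat (2 * n) w i j) /\
    hist_continuous (2 * n) (fun w => bhat (2 * n) w i j).
Proof.
move=> n0 cp i j ij; set t := (2 * n)%N.
have t2 : (2 <= t)%N by rewrite /t; move: n0; clear; lia.
have t0 : (0 < t)%N by exact: ltnW.
pose x w d := price d w i j; pose e w d := eps d w i j.
have LS w a b := least_squares_error R (x w) (e w) t (alpha i j) (beta i j) a b
  (price_det_gt0 w i j t ij t2).
have run_t w := (run w).2.1 t t0 i j ij.
pose u w := (sum_upto R (fun tau => x w tau ^+ 2) t * sum_upto R (e w) t
  - sum_upto R (x w) t * sum_upto R (fun tau => x w tau * e w tau) t) / gram_det R (x w) t.
pose v w := (sum_upto R (x w) t * sum_upto R (e w) t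
  - t%:R * sum_upto R (fun tau => x w tau * e w tau) t) / gram_det R (x w) t.
have -> : (fun w => ahat t w i j) = (fun w => clip amin amax (alpha i j + u w)).
  apply/funext => w; have [ls [-> _]] := run_t w.
  by have [-> _] := LS w _ _ ls.
have -> : (fun w => bhat t w i j) = (fun w => clip bmin bmax (beta i j + v w)).
  apply/funext => w; have [ls [_ ->]] := run_t w.
  by have [_ ->] := LS w _ _ ls.
have cx w tau : (0 < tau <= t)%N -> x z tau @[z --> H t w] --> x w tau.
  by move=> tt; exact: cp.
have ce w tau : (0 < tau <= t)%N -> e z tau @[z --> H t w] --> e w tau.
  by move=> tt; exact: shock_continuous.
have FF w : Filter (H t w) by exact: nearby_filter.
have csx w : sum_upto R (x z) t @[z --> H t w] --> sum_upto R (x w) t.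
  by apply: cvg_sum_upto; exact: cx.
have cse w : sum_upto R (e z) t @[z --> H t w] --> sum_upto R (e w) t.
  by apply: cvg_sum_upto; exact: ce.
have csxx w : sum_upto R (fun tau => x z tau ^+ 2) t @[z --> H t w] -->
    sum_upto R (fun tau => x w tau ^+ 2) t.
  by apply: cvg_sum_upto => tau tt; rewrite expr2; apply: cvgM; exact: cx.
have csxe w : sum_upto R (fun tau => x z tau * e z tau) t @[z --> H t w] -->
    sum_upto R (fun tau => x w tau * e w tau) t.
  by apply: cvg_sum_upto => tau tt; apply: cvgM; [exact: cx|exact: ce].
have cD w : (gram_det R (x z) t)^-1 @[z --> H t w] --> (gram_det R (x w) t)^-1.
  apply: cvgV; first by rewrite gt_eqF// price_det_gt0.
  by apply: cvg_gram_det; exact: cx.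
split=> w; apply: cvg_clip; (apply: cvgD; first exact: cvg_cst); apply: cvgM => //.
  by apply: cvgB; exact: cvgM.
by apply: cvgB; [exact: cvgM|apply: cvgM => //; exact: cvg_cst].
Qed.

(** Strong induction, because the estimate of time [2n] uses all earlier prices; the policy consults
    estimates at even times only. *)
Lemma est_continuous n i j : i != j ->
  hist_continuous (2 * n) (fun w => ahat (2 * n) w i j) /\
  hist_continuous (2 * n) (fun w => bhat (2 * n) w i j).
Proof.
elim/ltn_ind: n i j => n IH i j ij.
case: n IH => [|n] IH; first by rewrite muln0; exact: est0_continuous.
apply: est_continuous_step => // tau tt k l kl.
have [m mn] : exists2 m, (m < n.+1)%N & tau = (2 * m).+1 \/ tau = (2 * m).+2.
  case/andP: tt => tau0 tau_le; exists (tau.-1)./2.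
    by move: (odd_double_half tau.-1) tau0 tau_le; clear; lia.
  exact: odd_even_day.
have [c1 c2] := price_continuous_step m (fun i j ij => IH m mn i j ij) k l kl.
by case=> ->; [apply: hist_continuousW c1|apply: hist_continuousW c2]; move: mn; clear; lia.
Qed.

Lemma price_continuous d i j : i != j -> (0 < d)%N ->
  hist_continuous d.-1 (fun w => price d w i j).
Proof.
move=> ij d0.
have dE := odd_even_day d d0; set m := (d.-1)./2 in dE.
have [c1 c2] := price_continuous_step m (fun i j ij => est_continuous m i j ij) i j ij.
by case: dE => ->; [exact: c1|apply: hist_continuousW c2].
Qed.

Local Notation centered := (centered dsp Omega R P).

(** The gain involves prices up to day [tau.+1], which are fixed by the history up to [tau], and
    shocks up to [tau]; it is therefore a past variable for the shock of day [tau.+1]. *)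
Lemma gain_centered tau i j : i != j -> (2 <= tau)%N ->
  centered (fun w => eps tau.+1 w i j *
    noise_gain R (fun d => price d w i j) (fun d => eps d w i j) tau).
Proof.
move=> ij t2.
apply: (shock_centered dsp Omega R N P eps a0 b0 amin amax bmin bmax elo ehi _ _ _ _ _ _ _ tau) => //.
  have et : 0 <= eta by case/andP: eta_rng => /ltW.
  set X := price_bound; set E := shock_bound; set T : R := tau%:R.
  have c0 : 0 < explore 1 ^+ 2 by rewrite exprn_gt0// explore_gt0.
  (* The four terms of the numerator are bounded separately; the determinant never falls below its
     value at time 2. *)
  pose C := (T * X ^+ 2 * (T * E) + T * X * X * (T * E) + T * X * (T * (X * E))
    + T * X * (T * (X * E))) / explore 1 ^+ 2.
  exists C => w.
  pose x d := price d w i j; pose e d := eps d w i j.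
  have xX d : (0 < d)%N -> `|x d| <= X by move=> d0; exact: price_le.
  have eE d : (0 < d)%N -> `|e d| <= E by move=> _; exact: shock_le.
  have X0 : 0 <= X by exact: le_trans (xX 1%N isT).
  have E0 : 0 <= E by exact: le_trans (eE 1%N isT).
  have T0 : 0 <= T by exact: ler0n.
  have sx := sum_upto_le R x X tau xX.
  have se := sum_upto_le R e E tau eE.
  have sxx : `|sum_upto R (fun tau => x tau ^+ 2) tau| <= T * X ^+ 2.
    by apply: sum_upto_le => d d0; rewrite normrX lerXn2r ?nnegrE// xX.
  have sxe : `|sum_upto R (fun tau => x tau * e tau) tau| <= T * (X * E).
    by apply: sum_upto_le => d d0; rewrite normrM ler_pM// ?xX ?eE.
  have xt := xX tau.+1 isT.
  have D0 : explore 1 ^+ 2 <= gram_det R x tau.+1.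
    apply: (@le_trans _ _ (gram_det R x 2)).
      by have := price_det_ge 1 w i j ij; rewrite expr1n mul1r muln1.
    by apply: gram_det_ge2; [exact: price_det2_gt0|exact: ltnW].
  have Dp : 0 < gram_det R x tau.+1 by exact: lt_le_trans D0.
  rewrite /noise_gain -/x -/e normrM; apply: ler_pM => //; last first.
    by rewrite ger0_norm ?invr_ge0 ?(ltW Dp)// lef_pV2.
  apply: (le_trans (ler_normD _ _)); apply: lerD.
    apply: (le_trans (ler_normB _ _)); apply: lerD.
      apply: (le_trans (ler_normB _ _)); apply: lerD.
        by rewrite normrM ler_pM.
      rewrite !normrM; apply: ler_pM; rewrite ?mulr_ge0//.
      by apply: ler_pM.
    by rewrite normrM ler_pM.
  rewrite !normrM (ger0_norm T0); apply: ler_pM; rewrite ?mulr_ge0//.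
  by apply: ler_pM.
move=> w; apply: cvg_noise_gain.
- move=> d /andP[d0 dt]; apply: (hist_continuousW d.-1); first by rewrite -ltnS prednK.
  exact: price_continuous.
- by move=> d dt; exact: shock_continuous.
- by rewrite gt_eqF// price_det_gt0// ltnW.
Qed.


(** * Rate of learning *)

Definition noise_coef : R := 4 * (1 + price_bound ^+ 2) * (bmax / rho) ^+ 2.

Definition log_coef : R := 4 * shock_bound ^+ 2
  + shock_bound ^+ 2 * (2 * `|ln price_bound| + `|ln (explore 1 ^+ 2)|).

(** On each link, 1 comes from the weight [s * rate] in AM-GM, and the other term from the squared
    error divided by twice that weight. *)
Definition est_coef : R := link_sum R N (fun _ _ => 1 + noise_coef * log_coef / 2).

Lemma price_bound_gt0 : 0 < price_bound.
Proof.
rewrite /price_bound ltr_wpDl//; last by rewrite divr_gt0.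
by rewrite addr_ge0 ?mulr_ge0 ?est_diam_ge0 ?(ltW K_gt0)//; apply: link_sum_ge0.
Qed.

Lemma shock_bound_ge0 : 0 <= shock_bound.
Proof. exact: addr_ge0. Qed.

Lemma noise_coef_ge0 : 0 <= noise_coef.
Proof.
apply: mulr_ge0; last exact: sqr_ge0.
by apply: mulr_ge0 => //; apply: addr_ge0 => //; exact: sqr_ge0.
Qed.

Lemma log_coef_ge0 : 0 <= log_coef.
Proof.
have := sqr_ge0 shock_bound => E0.
by rewrite /log_coef addr_ge0 ?mulr_ge0 ?addr_ge0 ?mulr_ge0.
Qed.

Lemma est_coef_ge0 : 0 <= est_coef.
Proof.
apply: link_sum_ge0 => i j _.
by rewrite addr_ge0// divr_ge0// mulr_ge0 ?noise_coef_ge0 ?log_coef_ge0.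
Qed.

Local Notation rate n := ((2 * n)%:R `^ (eta - 2^-1) : R).

(** The rate is the usual [t^(-1/2)] divided by the perturbation size [t^(-eta)]. *)
Lemma rate_sqr n : (0 < n)%N ->
  rate n ^+ 2 = ((2 * n)%:R * ((2 * n)%:R `^ (- eta)) ^+ 2)^-1.
Proof.
move=> n0; set t : R := (2 * n)%:R.
have t0 : 0 < t by rewrite ltr0n muln_gt0.
have tn : t != 0 by rewrite gt_eqF.
have h : t `^ 2^-1 * t `^ (- eta) * t `^ (eta - 2^-1) = 1.
  rewrite -!powRD ?tn ?implybT// -[RHS](powRr0 t); congr (_ `^ _); ring.
have t2 : t `^ 2^-1 ^+ 2 = t by rewrite powR12_sqrt ?ltW// sqr_sqrtr// ltW.
rewrite -[X in (X * _)^-1]t2 -exprMn -exprVn; congr (_ ^+ 2).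
have hn : t `^ 2^-1 * t `^ (- eta) != 0 by rewrite mulf_neq0// gt_eqF// powR_gt0.
by apply: (mulfI hn); rewrite h mulfV.
Qed.

Lemma normalized_price_noise_le n D w i j : i != j -> (0 < n)%N -> (2 * n <= D)%N ->
  normalized_noise R (fun d => price d w i j) (fun d => eps d w i j) (2 * n) <=
  log_coef * (1 + ln D%:R) + \sum_(2 <= tau < 2 * n) 2 * (eps tau.+1 w i j *
    noise_gain R (fun d => price d w i j) (fun d => eps d w i j) tau).
Proof.
move=> ij n0 nD; set x := fun d => price d w i j; set e := fun d => eps d w i j.
have t2 : (2 <= 2 * n)%N by move: n0; clear; lia.
have D0 := price_det2_gt0 w i j ij.
have := normalized_noise_le R x e shock_bound (2 * n) (fun d => shock_le d w i j ij) D0 t2.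
move=> /le_trans; apply; rewrite lerD2r.
have t0 : 0 < (2 * n)%:R :> R by rewrite ltr0n muln_gt0.
have X0 := price_bound_gt0.
have tD : ln (2 * n)%:R <= ln D%:R :> R.
  by rewrite ler_ln ?posrE// ?ler_nat// ltr0n (leq_trans _ nD)// muln_gt0.
have lnt0 : 0 <= ln (2 * n)%:R :> R by apply: ln_ge0; rewrite ler1n ltnW.
have lt : ln (gram_det R x (2 * n)) <= 2 * ln D%:R + 2 * `|ln price_bound|.
  apply: (@le_trans _ _ (ln (((2 * n)%:R * price_bound) ^+ 2))).
    rewrite ler_ln ?posrE ?price_det_gt0 ?exprn_gt0 ?mulr_gt0//.
    by apply: gram_det_le => d d0; exact: price_le.
  rewrite lnXn ?mulr_gt0// lnM ?posrE// mulr2n.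
  by have := ler_norm (ln price_bound); lra.
have l2 : - `|ln (explore 1 ^+ 2)| <= ln (gram_det R x 2).
  apply: (@le_trans _ _ (ln (explore 1 ^+ 2))).
    by rewrite lerNl -normrN ler_norm.
  rewrite ler_ln ?posrE ?exprn_gt0 ?explore_gt0//.
  by have := price_det_ge 1 w i j ij; rewrite expr1n mul1r muln1.
have E2 : 0 <= shock_bound ^+ 2 by exact: sqr_ge0.
have lD : 0 <= ln D%:R :> R by exact: le_trans tD.
set B := 2 * `|ln price_bound| + `|ln (explore 1 ^+ 2)|.
have B0 : 0 <= B by rewrite addr_ge0// mulr_ge0.
have h1 := ler_wpM2l E2 (lerB lt l2).
have h2 := mulr_ge0 (mulr_ge0 E2 B0) lD.
have h3 := mulr_ge0 E2 lD.
rewrite /log_coef -/B; move: h1; rewrite opprK.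
have -> : 2 * ln D%:R + 2 * `|ln price_bound| + `|ln (explore 1 ^+ 2)| = 2 * ln D%:R + B.
  by rewrite /B addrA.
move: h2 h3 E2; lra.
Qed.

Lemma link_est_error n w i j s : i != j -> (0 < n)%N -> 0 < s ->
  `|ahat (2 * n) w i j - alpha i j| + `|bhat (2 * n) w i j - beta i j| <=
  s * rate n + noise_coef * rate n / (2 * s) *
    normalized_noise R (fun d => price d w i j) (fun d => eps d w i j) (2 * n).
Proof.
move=> ij n0 s0; set x := fun d => price d w i j; set e := fun d => eps d w i j.
set t := (2 * n)%N; set M := normalized_noise _ _ _ _.
have t2 : (2 <= t)%N by rewrite /t; move: n0; clear; lia.
have t0 : (0 < t)%N by exact: ltnW.
have q0 : 0 < rate n by rewrite powR_gt0// ltr0n.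
have D0 := price_det_gt0 w i j t ij t2.
have M0 : 0 <= M by exact: normalized_noise_ge0.
have [ls [-> ->]] := (run w).2.1 t t0 i j ij.
have [bA bB] := box i j ij.
apply: (le_trans (lerD (clip_dist _ _ _ _ (atil t w i j) bA) (clip_dist _ _ _ _ (btil t w i j) bB))).
apply: (le_trans (young_norm _ _ _ _ _ s0 q0)); rewrite lerD2l.
have sq0 : 0 < 2 * (s * rate n) by rewrite !mulr_gt0.
rewrite ler_pdivrMr//.
have -> : noise_coef * rate n / (2 * s) * M * (2 * (s * rate n)) = noise_coef * M * rate n ^+ 2.
  by field; rewrite gt_eqF.
have xX d : (0 < d)%N -> `|x d| <= price_bound by move=> d0; exact: price_le.
have := least_squares_error_le R x e t (alpha i j) (beta i j) _ _ price_bound t0 D0 xX ls.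
move=> /le_trans; apply.
have r0 := explore_gt0 n n0.
have m0 : 0 < n%:R ^+ 2 * explore n ^+ 2 by rewrite mulr_gt0 ?exprn_gt0// ltr0n.
apply: (@le_trans _ _ (t%:R * (1 + price_bound ^+ 2) * M / (n%:R ^+ 2 * explore n ^+ 2))).
  apply: ler_wpM2l.
    by apply: mulr_ge0 => //; apply: mulr_ge0 => //; apply: addr_ge0 => //; exact: sqr_ge0.
  by rewrite lef_pV2// price_det_ge.
(* With [t = 2 n] the quotient [t / n^2] becomes [4 / t], the origin of the 4 in [noise_coef]. *)
rewrite rate_sqr// /explore /noise_coef -/t.
set p := _ `^ _; have p0 : 0 < p by rewrite powR_gt0// ltr0n.
have tE : t%:R = 2 * n%:R :> R by rewrite /t natrM.
rewrite tE le_eqVlt; apply/orP; left; apply/eqP; field.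
have bM : 0 < bmax by exact: lt_le_trans bmin_bmax.
by rewrite !gt_eqF ?ltr0n.
Qed.

(** This [s] balances the two AM-GM terms: the noise is of order [1 + ln D = s^2], and dividing it
    by [s] leaves order [s] on both sides. A single [s] serves all days up to [D]. *)
Lemma est_error_bound n D s : (0 < n)%N -> (2 * n <= D)%N -> 0 < s -> s ^+ 2 = 1 + ln D%:R ->
  exists Z, centered Z /\ forall w, est_error (2 * n) w <= est_coef * (s * rate n) + Z w.
Proof.
move=> n0 nD s0 sE.
pose Z i j w := noise_coef * rate n / (2 * s) * \sum_(2 <= tau < 2 * n) 2 * (eps tau.+1 w i j *
    noise_gain R (fun d => price d w i j) (fun d => eps d w i j) tau).
have cZ i j : i != j -> centered (Z i j).
  move=> ij; apply: centeredZ; apply: centered_sum => tau.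
  rewrite mem_index_iota => /andP[t2 _] _; apply: centeredZ; exact: gain_centered.
exists (fun w => link_sum R N (fun i j => Z i j w)); split.
  apply: centered_sum => i _ _; apply: centered_sum => j _; rewrite eq_sym; exact: cZ.
move=> w; rewrite mulrC -link_sumZ -link_sumD; apply: le_link_sum => i j ij.
apply: (le_trans (link_est_error n w i j s ij n0 s0)).
have q0 : 0 < rate n by rewrite powR_gt0// ltr0n muln_gt0.
have k0 : 0 <= noise_coef * rate n / (2 * s).
  apply: divr_ge0; apply: mulr_ge0; rewrite ?noise_coef_ge0 ?(ltW s0) ?(ltW q0)//.
have := ler_wpM2l k0 (normalized_price_noise_le n D w i j ij n0 nD).
move=> /(lerD (lexx (s * rate n))) /le_trans; apply.
rewrite mulrDr addrA -/(Z i j w) lerD2r -sE.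
by rewrite le_eqVlt; apply/orP; left; apply/eqP; field; rewrite gt_eqF.
Qed.

(** * Loss of a single day *)

Definition demand_bound : R := `|amin| + `|amax| + bmax * price_bound + shock_bound.

(** First factor: sensitivity of the payoff to price and supply. Second factor: sensitivity of these
    decisions to the estimation error and the perturbation. Third: total weight of the links. *)
Definition payoff_coef : R := (price_bound * bmax + price_bound + demand_bound + c)
  * (K + 1 + price_bound + bmax * K + rho / bmin + rho) * link_sum R N xi.

Definition day_regret (d : nat) (w : Omega) : R :=
  payoff xi alpha beta c (pstar alpha beta)
    (fun i j => alpha i j - beta i j * pstar alpha beta i j) (eps d w)
  - payoff xi alpha beta c (price d w) (supply d w) (eps d w).

Lemma bmax_gt0 : 0 < bmax.
Proof. exact: lt_le_trans bmin_bmax. Qed.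

Lemma demand_bound_ge0 : 0 <= demand_bound.
Proof.
by rewrite !addr_ge0// ?mulr_ge0 ?(ltW bmax_gt0) ?(ltW price_bound_gt0) ?shock_bound_ge0.
Qed.

Lemma payoff_coef_ge0 : 0 <= payoff_coef.
Proof.
have X0 := ltW price_bound_gt0; have M0 := demand_bound_ge0.
have b0' := ltW bmax_gt0; have K0' := ltW K_gt0; have c0' := ltW c_gt0.
have r0' := ltW rho_gt0; have bm0' := ltW bmin_gt0.
apply: mulr_ge0; last by apply: link_sum_ge0 => i j ij; exact/ltW/xi_gt0.
move: price_bound demand_bound X0 M0 => X M X0 M0.
by apply: mulr_ge0; rewrite !addr_ge0 ?mulr_ge0 ?invr_ge0.
Qed.

Lemma pstar_le_bound i j : i != j -> `|pstar alpha beta i j| <= price_bound.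
Proof.
move=> ij; apply: (le_trans (pstar_le i j ij)); rewrite /price_bound -addrA lerDl.
apply: addr_ge0; first by apply: mulr_ge0; [exact: ltW|exact: est_diam_ge0].
by apply: divr_ge0; exact: ltW.
Qed.

Lemma decision_error d w i j : i != j -> (0 < d)%N ->
  let e := est_error (2 * d.-1./2) w + d%:R `^ (- eta) in
  `|price d w i j - pstar alpha beta i j|
  + `|supply d w i j - (alpha i j - beta i j * pstar alpha beta i j)| <=
  (K + 1 + price_bound + bmax * K + rho / bmin + rho) * e.
Proof.
move=> ij d0; cbv zeta; set k := d.-1./2; set e := est_error _ w; set dn := _ `^ _.
have X0 := ltW price_bound_gt0; have b0' := ltW bmax_gt0; have K0' := ltW K_gt0.
have r0' := ltW rho_gt0.
have rb0 : 0 <= rho / bmin by rewrite divr_ge0// ltW.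
have e0 : 0 <= e by exact: est_error_ge0.
have dn0 : 0 <= dn by exact: powR_ge0.
have pe := pstar_error (2 * k) w i j ij; rewrite -/e in pe.
have eE : `|ahat (2 * k) w i j - alpha i j| + `|bhat (2 * k) w i j - beta i j| <= e.
  by apply: (link_sum_term R N (fun i j => `|ahat (2 * k) w i j - alpha i j|
    + `|bhat (2 * k) w i j - beta i j|)) .
have [ae be] : `|ahat (2 * k) w i j - alpha i j| <= e /\ `|bhat (2 * k) w i j - beta i j| <= e.
  split; apply: le_trans eE; first by rewrite lerDl.
  by rewrite lerDr.
have pX : `|pstar alpha beta i j| <= price_bound.
  by exact: pstar_le_bound.
have [_ /andP[b1 b2]] := est_box (2 * k) w i j ij.
have bp : 0 < bhat (2 * k) w i j by exact: lt_le_trans b1.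
set p := pstar (ahat (2 * k) w) (bhat (2 * k) w) i j in pe.
have se : `|ahat (2 * k) w i j - bhat (2 * k) w i j * p
    - (alpha i j - beta i j * pstar alpha beta i j)| <= e + e * price_bound + bmax * (K * e).
  have -> : ahat (2 * k) w i j - bhat (2 * k) w i j * p
    - (alpha i j - beta i j * pstar alpha beta i j) = (ahat (2 * k) w i j - alpha i j)
    - (bhat (2 * k) w i j - beta i j) * pstar alpha beta i j
    - bhat (2 * k) w i j * (p - pstar alpha beta i j) by ring.
  apply: (le_trans (ler_normB _ _)); apply: lerD; last first.
    by rewrite normrM ler_pM// ger0_norm// ltW.
  apply: (le_trans (ler_normB _ _)); apply: lerD => //.
  by rewrite normrM ler_pM.
have [pd sd] : `|price d w i j - pstar alpha beta i j| <= K * e + rho / bmin * dn /\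
    `|supply d w i j - (alpha i j - beta i j * pstar alpha beta i j)| <=
      e + e * price_bound + bmax * (K * e) + rho * dn.
  have [dE|dE] := odd_even_day d d0; rewrite -/k in dE.
    have od : odd d by rewrite dE /= mul2n odd_double.
    have [_ [_ [/(_ d od i j ij)[-> ->] _]]] := run w.
    have -> : d.-1 = (2 * k)%N by rewrite dE.
    rewrite -/p; split.
      by apply: (le_trans pe); rewrite lerDl mulr_ge0.
    by apply: (le_trans se); rewrite lerDl mulr_ge0.
  have od : ~~ odd d by rewrite dE /= mul2n odd_double.
  have [_ [_ [_ /(_ d d0 od i j ij)[-> ->]]]] := run w.
  have -> : (d - 2)%N = (2 * k)%N by rewrite dE subn2.
  rewrite -/p -/dn; split.
    rewrite addrAC; apply: (le_trans (ler_normB _ _)); apply: lerD => //.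
    have /andP[h1 h2] := perturb_le (2 * k) w i j d ij d0.
    by rewrite ger0_norm.
  rewrite addrAC; apply: (le_trans (ler_normD _ _)); apply: lerD => //.
  by rewrite ger0_norm// mulr_ge0.
apply: (le_trans (lerD pd sd)).
have h1 : 0 <= K * dn by rewrite mulr_ge0.
have h2 : 0 <= price_bound * dn by rewrite mulr_ge0.
have h3 : 0 <= bmax * K * dn by rewrite !mulr_ge0.
have h4 : 0 <= rho / bmin * e by rewrite mulr_ge0.
have h5 : 0 <= rho * e by rewrite mulr_ge0.
by lra.
Qed.

Lemma day_regret_le d w : (0 < d)%N ->
  day_regret d w <= payoff_coef * (est_error (2 * d.-1./2) w + d%:R `^ (- eta)).
Proof.
move=> d0; set e := _ + _ `^ _.
pose p := pstar alpha beta.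
have X0 := ltW price_bound_gt0; have b0' := ltW bmax_gt0; have M0 := demand_bound_ge0.
rewrite /day_regret /payoff -!/(link_sum R N _) -!link_sumB /payoff_coef.
have -> : (price_bound * bmax + price_bound + demand_bound + c) *
   (K + 1 + price_bound + bmax * K + rho / bmin + rho) * link_sum R N xi * e =
   link_sum R N (fun i j => (price_bound * bmax + price_bound + demand_bound + c) *
   ((K + 1 + price_bound + bmax * K + rho / bmin + rho) * e) * xi i j).
  by rewrite link_sumZ; ring.
apply: le_link_sum => i j ij; have xi0 := xi_gt0 i j ij.
set q := price d w i j; set v := supply d w i j; set v0 := alpha i j - _ * _.
set m0 := Num.min _ v0; set m := Num.min _ v.
rewrite -[pstar alpha beta i j]/(p i j).
have -> : xi i j * m0 * p i j - xi i j * v0 * c - (xi i j * m * q - xi i j * v * c) =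
   ((m0 - m) * q + m0 * (p i j - q) + (v - v0) * c) * xi i j by ring.
rewrite ler_pM2r//.
have /= de := decision_error d w i j ij d0; rewrite -/e -/q -/v -/(p i j) -/v0 in de.
set dp := `|q - p i j| in de; set dv := `|v - v0| in de.
have dp0 : 0 <= dp := normr_ge0 _; have dv0 : 0 <= dv := normr_ge0 _.
have [/andP[a1 a2] /andP[b1 b2]] := box i j ij.
have bp : 0 <= beta i j by apply: le_trans b1; exact: ltW.
have eE := shock_le d w i j ij.
have pX : `|p i j| <= price_bound.
  exact: pstar_le_bound.
have qX : `|q| <= price_bound by exact: price_le.
have mm : `|m0 - m| <= bmax * dp + dv.
  apply: (le_trans (min_dist _ _ _ _ _)); apply: lerD; last by rewrite distrC.
  have -> : alpha i j - beta i j * pstar alpha beta i j + eps d w i j -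
     (alpha i j - beta i j * q + eps d w i j) = beta i j * (q - p i j) by rewrite /p; ring.
  by rewrite normrM ger0_norm// ler_wpM2r.
have aA : `|alpha i j| <= `|amin| + `|amax|.
  rewrite ler_norml; have := ler_norm amax; have := ler_norm (- amin); rewrite normrN.
  move: (normr_ge0 amax) (normr_ge0 amin) a1 a2; move=> *.
  by apply/andP; split; lra.
have v0B : `|v0| <= `|amin| + `|amax| + bmax * price_bound.
  apply: (le_trans (ler_normB _ _)); apply: lerD => //.
  by rewrite normrM ler_pM// ger0_norm.
have m0B : `|m0| <= demand_bound.
  rewrite /m0 /demand_bound; case: (lerP (v0 + eps d w i j) v0) => _.
    by apply: (le_trans (ler_normD _ _)); apply: lerD.
  by apply: (le_trans v0B); rewrite lerDl shock_bound_ge0.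
have t1 : (m0 - m) * q <= (bmax * dp + dv) * price_bound.
  by apply: (le_trans (ler_norm _)); rewrite normrM ler_pM.
have t2 : m0 * (p i j - q) <= demand_bound * dp.
  by apply: (le_trans (ler_norm _)); rewrite normrM distrC ler_pM.
have t3 : (v - v0) * c <= dv * c.
  by rewrite ler_pM2r// ler_norm.
apply: (le_trans (lerD (lerD t1 t2) t3)).
have L0 : 0 <= price_bound * bmax + price_bound + demand_bound + c.
  apply: addr_ge0; last exact: ltW.
  by apply: addr_ge0 => //; apply: addr_ge0 => //; exact: mulr_ge0.
apply: le_trans (ler_wpM2l L0 de).
have h1 := mulr_ge0 X0 dp0.
have h2 := mulr_ge0 (mulr_ge0 X0 b0') dv0.
have h3 := mulr_ge0 M0 dv0.
have h4 := mulr_ge0 (ltW c_gt0) dp0.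
by move: h1 h2 h3 h4; lra.
Qed.

(** * Summation over the days *)

Definition learn_coef : R := 2 * est_coef * payoff_coef.

Lemma sum_first_two (D : nat) (k : R) : (2 <= D)%N ->
  \sum_(1 <= d < D.+1) (if (d <= 2)%N then k else 0) = 2 * k.
Proof.
move=> D2; rewrite big_ltn ?ltnS ?(ltnW D2)// big_ltn ?ltnS// big_nat big1.
  by rewrite /= addr0 mulr_natl mulr2n.
by move=> d /andP[d3 _]; rewrite leqNgt d3.
Qed.

Lemma day_regret_centered d D s : (0 < d)%N -> (d <= D)%N -> 0 < s -> s ^+ 2 = 1 + ln D%:R ->
  exists Z, centered Z /\ forall w, day_regret d w <=
    payoff_coef * (if (d <= 2)%N then est_diam else 0)
    + learn_coef * s * d%:R `^ (- (2^-1 - eta)) + payoff_coef * d%:R `^ (- eta) + Z w.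
Proof.
move=> d0 dD s0 sE; have C0 := payoff_coef_ge0; have e0 := est_coef_ge0.
have L0 : 0 <= learn_coef by rewrite /learn_coef mulr_ge0// mulr_ge0.
have s0' := ltW s0.
(* Days 1 and 2 use the arbitrary initial estimate, so only the diameter of the box bounds their
   error; they produce the [D^-1] term. *)
have [d2|d2] := leqP d 2.
  exists (fun=> 0); split; first exact: centered0.
  move=> w; rewrite addr0; apply: (le_trans (day_regret_le d w d0)); rewrite mulrDr lerD2r.
  apply: (@le_trans _ _ (payoff_coef * est_diam)); first by rewrite ler_wpM2l// est_error_le.
  by rewrite lerDl mulr_ge0 ?powR_ge0// mulr_ge0.
set n := d.-1./2.
have n0 : (0 < n)%N by rewrite half_gt0 -ltnS prednK.
have nd : (2 * n <= D)%N.
  by apply: leq_trans dD; have [|] := odd_even_day d d0 => ->; rewrite -/n ltnW// ltnW.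
have dn : (d <= 2 * (2 * n))%N.
  by have dE := odd_even_day d d0; move: dE n0; rewrite -/n; clear; lia.
have [Z [cZ Zle]] := est_error_bound n D s n0 nd s0 sE.
exists (fun w => payoff_coef * Z w); split; first exact: centeredZ.
move=> w; rewrite mulr0 add0r; apply: (le_trans (day_regret_le d w d0)).
rewrite mulrDr -/n addrAC lerD2r.
apply: (le_trans (ler_wpM2l C0 (Zle w))); rewrite mulrDr lerD2r.
(* The 2 in [learn_coef] pays for replacing the estimation time [2n] by the day [d]. *)
have -> : learn_coef * s * d%:R `^ (- (2^-1 - eta)) =
  payoff_coef * (est_coef * (s * (2 * d%:R `^ (- (2^-1 - eta))))) by rewrite /learn_coef; ring.
do 3!apply: ler_wpM2l => //.
rewrite -(opprB 2^-1 eta); apply: powR_double => //; last by rewrite muln_gt0.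
case/andP: eta_rng => h1 h2; apply/andP; split; lra.
Qed.

Lemma regret_le D : 4 + expR ((1 - 2 * eta)^-1) < D%:R ->
  (regret P eps xi alpha beta c pstar price supply D <=
    (2 * payoff_coef * est_diam * (D%:R)^-1
     + 2 * learn_coef / (2^-1 + eta) * (ln (D%:R : R) `^ 2^-1) * ((D%:R : R) `^ (eta - 2^-1))
     + payoff_coef / (1 - eta) * ((D%:R : R) `^ (- eta)))%:E)%E.
Proof.
move=> D4; have [eta0 eta1] := andP eta_rng.
have k0 : 0 < 1 - 2 * eta by lra.
have D4' : 4 < D%:R :> R by apply: le_lt_trans D4; rewrite lerDl expR_ge0.
have D0 : 0 < D%:R :> R by apply: lt_trans D4'.
have D2 : (2 <= D)%N by rewrite -(ler_nat R); apply: ltW; apply: le_lt_trans D4'; lra.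
(* Since [(1 - 2 eta)^-1 >= 1], the horizon exceeds [e]; then [1 + ln D] is at most [2 * ln D], and
   [s] can be traded for the square root of [ln D]. *)
have lnD : 1 <= ln D%:R :> R.
  rewrite -[X in X <= _](expRK 1) ler_ln ?posrE ?expR_gt0//.
  apply: (@le_trans _ _ (expR ((1 - 2 * eta)^-1))); last by apply/ltW/(lt_trans _ D4); rewrite ltrDr.
  by rewrite ler_expR invf_ge1//; lra.
pose s : R := Num.sqrt (1 + ln D%:R).
have s0 : 0 < s by rewrite sqrtr_gt0; lra.
have sE : s ^+ 2 = 1 + ln D%:R by rewrite sqr_sqrtr//; lra.
have sle : s <= 2 * ln D%:R `^ 2^-1.
  have l0 : 0 <= 2 * ln D%:R `^ 2^-1 :> R by rewrite mulr_ge0 ?powR_ge0.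
  rewrite -ler_sqr ?nnegrE ?(ltW s0)// sE exprMn powR12_sqrt; last lra.
  by rewrite sqr_sqrtr; lra.
(* One remainder is chosen for each day; days outside the horizon receive 0 as a default. *)
have /choice[Z ZP] : forall d, exists Z, (0 < d)%N -> (d <= D)%N -> centered Z /\
    forall w, day_regret d w <=
    payoff_coef * (if (d <= 2)%N then est_diam else 0)
    + learn_coef * s * d%:R `^ (- (2^-1 - eta)) + payoff_coef * d%:R `^ (- eta) + Z w.
  move=> d; have [d0|d0] := leqP d 0; first by exists (fun=> 0).
  have [dD|dD] := leqP d D; last by exists (fun=> 0).
  have [Z ZP] := day_regret_centered d D s d0 dD s0 sE.
  by exists Z.
pose k := (D%:R)^-1 * \sum_(1 <= d < D.+1)
  (payoff_coef * (if (d <= 2)%N then est_diam else 0)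
    + learn_coef * s * d%:R `^ (- (2^-1 - eta)) + payoff_coef * d%:R `^ (- eta)).
have cZ : centered (fun w => (D%:R)^-1 * \sum_(1 <= d < D.+1) Z d w).
  apply: centeredZ; apply: centered_sum => d; rewrite mem_index_iota => /andP[d0 dD] _.
  by have [] := ZP d d0 dD.
apply: (@le_trans _ _ k%:E).
  apply: integral_le_centered cZ _ => w.
  rewrite /k -mulrDr ler_pM2l ?invr_gt0// -big_split; apply: ler_sum_nat => d /andP[d0 dD].
  by have [_] := ZP d d0 dD; apply.
rewrite lee_fin /k !big_split /= -!mulr_sumr sum_first_two// !mulrDr.
have C0 := payoff_coef_ge0; have e0 := est_coef_ge0.
have L0 : 0 <= learn_coef by rewrite /learn_coef mulr_ge0// mulr_ge0.
(* Dividing by [D] turns the sum, of order [D^(1 - r)], back into the order [D^(-r)] of its last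
   term. *)
have avg (r : R) : 0 < r < 1 ->
    (D%:R)^-1 * \sum_(1 <= d < D.+1) d%:R `^ (- r) <= D%:R `^ (- r) / (1 - r).
  move=> r01; have := powR_sum_le R r D r01.
  rewrite -(ler_pM2l (_ : 0 < D%:R^-1)) ?invr_gt0// => /le_trans; apply.
  rewrite mulrA ler_wpM2r//; first by rewrite invr_ge0 subr_ge0; case/andP: r01 => _ /ltW.
  rewrite -(powR_inv1 (ltW D0)) -powRD ?(gt_eqF D0) ?implybT//.
  by rewrite (_ : -1 + (1 - r) = - r)//; ring.
apply: lerD; first apply: lerD.
- by rewrite le_eqVlt; apply/orP; left; apply/eqP; ring.
- rewrite mulrCA.
  have h : 0 < 2^-1 - eta < 1 by apply/andP; split; lra.
  have Ls : 0 <= learn_coef * s by rewrite mulr_ge0// ltW.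
  apply: (le_trans (ler_wpM2l Ls (avg _ h))).
  rewrite opprB (_ : 1 + (eta - 2^-1) = 2^-1 + eta); last by field.
  have h0 : 0 <= D%:R `^ (eta - 2^-1) / (2^-1 + eta) :> R.
    by apply: divr_ge0; [exact: powR_ge0|lra].
  apply: (le_trans (ler_wpM2r h0 (ler_wpM2l L0 sle))).
  by rewrite le_eqVlt; apply/orP; left; apply/eqP; field; rewrite gt_eqF//; lra.
rewrite mulrCA.
have h : 0 < eta < 1 by apply/andP; split; lra.
apply: (le_trans (ler_wpM2l C0 (avg _ h))).
by rewrite le_eqVlt; apply/orP; left; apply/eqP; ring.
Qed.

End Run.

Theorem theorem2 (R : realType) (N : nat)
  (alpha beta xi : lnk R N) (amin amax bmin bmax pmax c elo ehi : R)
  (dsp : measure_display) (Omega : measurableType dsp) (P : probability Omega R)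
  (eps : nat -> Omega -> lnk R N) (a0 b0 : Omega -> lnk R N)
  (pstar : lnk R N -> lnk R N -> lnk R N) :
  0 < amin -> amin <= amax -> 0 < bmin -> bmin <= bmax ->
  in_box amin amax bmin bmax alpha beta ->
  (forall i j : 'I_N, i != j -> 0 < xi i j) ->
  0 < c -> c < pmax ->
  0 <= amin - bmax * pmax + elo ->
  (* shocks: bounded, measurable, mean zero, i.i.d. over days, independent of theta^0 *)
  (forall (dd : nat) (w : Omega) (i j : 'I_N), i != j -> elo <= eps dd w i j <= ehi) ->
  (forall (dd : nat) (i j : 'I_N), measurable_fun setT (fun w => eps dd w i j)) ->
  (forall i j : 'I_N, i != j -> (\int[P]_w (eps 1%N w i j)%:E = 0)%E) ->
  shocks_iid_indep P eps a0 b0 ->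
  (* initial estimate theta^0: random, with values in the box *)
  (forall i j : 'I_N, measurable_fun setT (fun w => a0 w i j)) ->
  (forall i j : 'I_N, measurable_fun setT (fun w => b0 w i j)) ->
  (forall w : Omega, in_box amin amax bmin bmax (a0 w) (b0 w)) ->
  (* pstar a b is the optimal solution of the price-only problem with parameters (a,b) *)
  (forall a b : lnk R N, in_box amin amax bmin bmax a b ->
     is_opt xi (epsminus P eps) c pmax a b (pstar a b)) ->
  (* mu*_ij = 0 for all links *)
  zero_cap_dual xi (epsminus P eps) c pmax alpha beta ->
  exists Phi2 Phi3 Phi4 : R -> R -> R,
    (forall rho eta : R, 0 < rho -> 0 < eta < 2^-1 ->
       0 < Phi2 rho eta /\ 0 < Phi3 rho eta /\ 0 < Phi4 rho eta) /\
    (forall (rho eta : R) (price supply ahat bhat atil btil : nat -> Omega -> lnk R N),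
       0 < rho -> 0 < eta < 2^-1 ->
       nrps_run eps a0 b0 alpha beta amin amax bmin bmax pstar rho eta
                price supply ahat bhat atil btil ->
       (* hat mu^{d-1,*}_ij = 0 for all links and all days d *)
       (forall (w : Omega) (dd : nat), (0 < dd)%N ->
          zero_cap_dual xi (epsminus P eps) c pmax (ahat dd.-1 w) (bhat dd.-1 w)) ->
       forall D : nat, 4 + expR ((1 - 2 * eta)^-1) < D%:R ->
         (regret P eps xi alpha beta c pstar price supply D
          < (Phi2 rho eta * (D%:R)^-1
             + Phi3 rho eta * (ln (D%:R : R) `^ 2^-1) * ((D%:R : R) `^ (eta - 2^-1))
             + Phi4 rho eta * ((D%:R : R) `^ (- eta)))%:E)%E).
Proof.
move=> amin0 amm bmin0 bmm box xi0 c0 cp _ erng emeas emean indep am bm box0 popt zc.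
have kkt0 : kkt R N xi (epsminus P eps) c alpha beta (pstar alpha beta).
  apply: (zero_cap_kkt _ _ _ _ _ pmax) => //; last exact: popt.
  by move=> i j /(box i j)[_ /andP[+ _]]; exact: lt_le_trans.
(* With the true parameters as base point, this constant is fixed before [rho], [eta] and the
   run. *)
have [K K0 Klip] := kkt_lipschitz _ _ _ _ _ _ _ _ _ _ _ _ xi0 bmin0 box kkt0.
pose C2 := payoff_coef R N alpha beta xi amin amax bmin bmax c elo ehi pstar K.
pose C3 := learn_coef R N alpha beta xi amin amax bmin bmax c elo ehi pstar K.
pose diam := est_diam R N amin amax bmin bmax.
have diam0 : 0 <= diam by exact: est_diam_ge0.
(* The added 1 makes each coefficient positive, and in the first term it makes the inequality
   strict. *)
exists (fun rho eta => 2 * C2 rho * diam + 1),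
  (fun rho eta => 2 * C3 rho eta / (2^-1 + eta) + 1),
  (fun rho eta => C2 rho / (1 - eta) + 1).
have C20 rho : 0 < rho -> 0 <= C2 rho by move=> ?; exact: payoff_coef_ge0.
have C30 rho eta : 0 < rho -> 0 <= C3 rho eta.
  move=> rho0; apply: mulr_ge0; last exact: C20.
  by apply: mulr_ge0 => //; exact: est_coef_ge0.
split=> [rho eta rho0 /andP[eta0 eta1]|rho eta price supply ahat bhat atil btil rho0 etaI run zcap D D4].
  have C2p := C20 _ rho0; have C3p := C30 _ eta rho0.
  split; first by rewrite ltr_wpDl// mulr_ge0// mulr_ge0.
  split; (apply: ltr_wpDl; last by []); apply: divr_ge0; lra.
apply: (@le_lt_trans _ _ (2 * C2 rho * diam * (D%:R)^-1
  + 2 * C3 rho eta / (2^-1 + eta) * (ln (D%:R : R) `^ 2^-1) * ((D%:R : R) `^ (eta - 2^-1))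
  + C2 rho / (1 - eta) * ((D%:R : R) `^ (- eta)))%:E).
  by apply: (@regret_le _ _ _ _ _ _ _ _ _ pmax _ _ _ _ _ _ _ a0 b0) D4.
have D0 : 0 < D%:R :> R.
  by apply: lt_trans D4; rewrite ltr_wpDr ?expR_ge0.
rewrite lte_fin; apply: ltr_leD; first apply: ltr_leD.
- by rewrite ltr_pM2r ?invr_gt0// ltrDl.
- by do 2![apply: ler_wpM2r; first exact: powR_ge0]; rewrite lerDl.
by apply: ler_wpM2r; [exact: powR_ge0|rewrite lerDl].
Qed.
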